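(* There exists a function $\mathrm{A}:2^{<\omega}\to\mathbb{N}$ satisfying all of the following: (1) $\mathrm{A}$ is upper semi-computable; (2) for every partial computable function $f:2^{<\omega}\to 2^{<\omega}$ there exists a constant $c_f$ such that $\mathrm{A}(f(x))\le \mathrm{A}(x)+c_f$ for every $x$ in the domain of $f$; (3) $\sum_{x\in 2^{<\omega}} 2^{-\mathrm{A}(x)}<\infty$; (4) there is a constant $c$ such that $\mathrm{A}(x)\le |x|+\mathrm{A}(|x|)+c$ for every $x\in 2^{<\omega}$ (where the number $|x|$ is identified with a string); (5) there is a constant $c'$ such that for all $n,b\in\mathbb{N}$, $\left|\{x\in 2^{<\omega} : |x|=n,\ \mathrm{A}(x)\le n+\mathrm{A}(n)-b\}\right|\le c'\cdot 2^{n-b}$; (6) $|\mathrm{A}(x)-\mathrm{K}(x)|$ is unbounded as $x$ ranges over $2^{<\omega}$.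
   Context: $2^{<\omega}$ denotes the set of finite binary strings, identified with natural numbers in the standard way; $|x|$ is the length of $x$. A function $\mathrm{A}:2^{<\omega}\to\mathbb{N}$ is upper semi-computable if the predicate ''$\mathrm{A}(x)\le k$'' is computably enumerable uniformly in $x,k$. For a machine $T$, $\mathrm{C}_T(x)=\min\{|y| : T(y)=x\}$. A prefix-free machine is one whose domain is prefix-free; fix an optimal prefix-free machine $\mathbb{U}'$ (for every prefix-free machine $T$ there is $c_T$ with $\mathrm{C}_{\mathbb{U}'}\le \mathrm{C}_T+c_T$) and let $\mathrm{K}=\mathrm{C}_{\mathbb{U}'}$ be prefix-free Kolmogorov complexity. *)

(* Defs.v *)
From Stdlib Require Import Arith List ZArith Reals.
Import ListNotations.

Inductive prf : Type :=
| PZero : prf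
| PSucc : prf
| PProj : nat -> prf
| PComp : prf -> list prf -> prf
| PRec  : prf -> prf -> prf
| PMin  : prf -> prf.

Inductive eval : prf -> list nat -> nat -> Prop :=
| ev_zero v : eval PZero v 0
| ev_succ x v : eval PSucc (x :: v) (S x)
| ev_proj i v : i < length v -> eval (PProj i) v (nth i v 0)
| ev_comp f gs v ws y : evals gs v ws -> eval f ws y -> eval (PComp f gs) v y
| ev_rec0 f g v y : eval f v y -> eval (PRec f g) (0 :: v) y
| ev_recS f g n v y z :
    eval (PRec f g) (n :: v) y -> eval g (n :: y :: v) z ->
    eval (PRec f g) (S n :: v) z
| ev_min f v n :
    eval f (n :: v) 0 ->
    (forall m, m < n -> exists k, eval f (m :: v) (S k)) ->
    eval (PMin f) v n
with evals : list prf -> list nat -> list nat -> Prop :=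
| evs_nil v : evals [] v []
| evs_cons g gs v w ws : eval g v w -> evals gs v ws -> evals (g :: gs) v (w :: ws).

(** * Finite binary strings, identified with naturals in the standard way:
    empty <-> 0, "0" <-> 1, "1" <-> 2, "00" <-> 3, ... (first bit most significant). *)
Definition str := list bool.

Definition nat_of_str (s : str) : nat :=
  fold_left (fun n (b : bool) => 2 * n + 1 + (if b then 1 else 0)) s 0.

Fixpoint str_of_nat_aux (fuel n : nat) : str :=
  match fuel with
  | 0 => []
  | S f => match n with
           | 0 => []
           | S _ => str_of_nat_aux f (Nat.div2 (pred n)) ++ [negb (Nat.odd n)]
           end
  end.

Definition str_of_nat (n : nat) : str := str_of_nat_aux n n.

Fixpoint all_strs (n : nat) : list str :=
  match n with
  | 0 => [[]]
  | S m => flat_map (fun s => [false :: s; true :: s]) (all_strs m)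
  end.

Definition partial_computable (f : str -> option str) : Prop :=
  exists p : prf, forall x y : str,
    eval p [nat_of_str x] (nat_of_str y) <-> f x = Some y.

(** A : strings -> N is upper semi-computable: "A x <= k" is c.e. uniformly
    in x, k, i.e. it is the domain of a partial computable function of (x,k). *)
Definition upper_semicomputable (A : str -> nat) : Prop :=
  exists p : prf, forall (x : str) (k : nat),
    A x <= k <-> exists y, eval p [nat_of_str x; k] y.

Definition is_prefix (y y' : str) : Prop := exists z, y' = y ++ z.

Definition prefix_free_machine (T : str -> option str) : Prop :=
  partial_computable T /\
  forall y y', T y <> None -> T y' <> None -> is_prefix y y' -> y = y'.

Definition C_is (T : str -> option str) (x : str) (k : nat) : Prop :=
  (exists y, T y = Some x /\ length y = k) /\
  (forall y, T y = Some x -> k <= length y).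

(** Optimal prefix-free machine: C_U <= C_T + c_T for every prefix-free T
    (where C_T(x) = infinity when x is not in the range of T). *)
Definition optimal_prefix_free (U : str -> option str) : Prop :=
  prefix_free_machine U /\
  forall T, prefix_free_machine T ->
    exists c : nat, forall x k, C_is T x k ->
      exists k', C_is U x k' /\ k' <= k + c.

(* Main.v *)
Require Import Defs.
From Stdlib Require Import Arith List ZArith Reals.
From Stdlib Require Import Lia Lra Classical ClassicalEpsilon FinFun.
Import ListNotations.

(** Let B be a busy-beaver-like function, approximable from below, with
    B k > k + n for every number n of complexity at most k, and let g j be the
    least i such that B iterated i times from 0 reaches j. The function
    A x = K x + g (K x) works: g is nondecreasing, unbounded, approximable from
    above, and satisfies g (k + c) <= g k + c, so A inherits (1)-(3) from K and
    A - K is unbounded. Since n + K n < B (K n), also g (n + K n) <= g (K n) + 1,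
    which gives (4). For (5), K n <= K x + O(1) when |x| = n, hence
    g (K n) <= g (K x) + O(1), and A x <= n + A n - b forces
    K x <= n + K n - b + O(1); the number of such x is bounded by applying the
    coding theorem to the lengths of the outputs of [U]. *)

(** * Computable functions *)

(** The obstacle to a simpler [g] is (4). Most x of length n have K x within O(1) of n + K n, so [g]
    may grow only by O(1) between K n and n + K n, while n is not bounded by any computable function
    of K n. An unbounded computable [g] is therefore too fast; inverting iterates of a busy beaver
    works because n is itself the output of a program of length K n, so one more iteration bridges
    the gap.

    Programs are terms [prf], and no universal function is at hand. Each term instead receives its
    own total evaluator with a search bound, built by induction on the term. Every machine below
    then arises from one pattern: search for a code e of some witnesses together with a bound, test
    it by a total computable function, and read the output off e. The coding theorem needs machines
    given by a computable list of length requests, which is what [kraft_chaitin] supplies. *)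

(** [PComp] nests [prf] inside [list], so an induction hypothesis for the arguments [gs] has to be
    supplied by hand. *)
Definition prf_nested_ind (P : prf -> Prop)
  (HZ : P PZero) (HS : P PSucc) (HP : forall i, P (PProj i))
  (HC : forall f gs, P f -> Forall P gs -> P (PComp f gs))
  (HR : forall f g, P f -> P g -> P (PRec f g))
  (HM : forall f, P f -> P (PMin f)) : forall p, P p :=
  fix rec p := match p with
  | PZero => HZ
  | PSucc => HS
  | PProj i => HP i
  | PComp f gs => HC f gs (rec f)
      ((fix recs l : Forall P l := match l with
        | [] => Forall_nil _
        | g :: l' => Forall_cons _ (rec g) (recs l')
        end) gs)
  | PRec f g => HR f g (rec f) (rec g)
  | PMin f => HM f (rec f)
  end.

(** [F] takes a whole list, so that variables are terms [nth i v 0] and the closure lemmas apply by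
    unification. Its values at lists of other lengths are irrelevant. *)
Definition total_computable (n : nat) (F : list nat -> nat) : Prop :=
  exists p, forall v, length v = n -> eval p v (F v).

(** * Closure properties of total computable functions *)

Lemma tc_ext n F G :
  total_computable n F -> (forall v, length v = n -> F v = G v) ->
  total_computable n G.
Proof. intros [p Hp] H. exists p. intros v Hv. rewrite <- H by easy. auto. Qed.

Lemma tc_var n i : i < n -> total_computable n (fun v => nth i v 0).
Proof. intros Hi. exists (PProj i). intros v Hv. constructor. lia. Qed.

Lemma tc_comp n m F Gs :
  total_computable m F -> length Gs = m -> Forall (total_computable n) Gs ->
  total_computable n (fun v => F (map (fun G => G v) Gs)).
Proof.
  intros [p Hp] Hm HG.
  assert (exists gs, forall v, length v = n ->
            evals gs v (map (fun G => G v) Gs)) as [gs Hgs].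
  { clear Hm. induction HG as [|G Gs [g Hg] _ [gs IH]].
    - exists []. intros. constructor.
    - exists (g :: gs). intros v Hv. simpl. constructor; auto. }
  exists (PComp p gs). intros v Hv. econstructor; [now apply Hgs|].
  apply Hp. rewrite length_map. easy.
Qed.

(** Reduces closure under an operation to the case where its arguments are variables. *)
Lemma tc_app1 f n F :
  total_computable 1 (fun v => f (nth 0 v 0)) -> total_computable n F ->
  total_computable n (fun v => f (F v)).
Proof.
  intros Hf HF. apply (tc_comp n 1 _ [F] Hf); [easy|]. repeat constructor; easy.
Qed.

Lemma tc_app2 f n F G :
  total_computable 2 (fun v => f (nth 0 v 0) (nth 1 v 0)) ->
  total_computable n F -> total_computable n G ->
  total_computable n (fun v => f (F v) (G v)).
Proof.
  intros Hf HF HG. apply (tc_comp n 2 _ [F; G] Hf); [easy|]. repeat constructor; easy.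
Qed.

Lemma tc_succ n F : total_computable n F -> total_computable n (fun v => S (F v)).
Proof.
  apply (tc_app1 S). exists PSucc. intros [|x v] Hv; [easy|]. constructor.
Qed.

Lemma tc_const n c : total_computable n (fun _ => c).
Proof.
  induction c; [|now apply tc_succ].
  exists PZero. intros. constructor.
Qed.

(** The prefix [w] makes the induction go through, and later serves to drop leading arguments. *)
Lemma evals_projections w v : evals (map PProj (seq (length w) (length v))) (w ++ v) v.
Proof.
  revert w. induction v as [|x v IH]; intros w; simpl; constructor.
  - pose proof (ev_proj (length w) (w ++ x :: v)) as H.
    rewrite app_nth2, Nat.sub_diag in H by lia. apply H.
    rewrite length_app. simpl. lia.
  - specialize (IH (w ++ [x])). rewrite <- app_assoc, length_app, Nat.add_comm in IH.
    exact IH.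
Qed.

Fixpoint prim_rec (a : nat) (g : nat -> nat -> nat) (n : nat) : nat :=
  match n with 0 => a | S m => g m (prim_rec a g m) end.

Lemma tc_rec n F G H :
  total_computable n F -> total_computable (S (S n)) G -> total_computable n H ->
  total_computable n
    (fun v => prim_rec (F v) (fun m y => G (m :: y :: v)) (H v)).
Proof.
  intros [f Hf] [g Hg] [h Hh].
  exists (PComp (PRec f g) (h :: map PProj (seq 0 n))). intros v Hv.
  apply ev_comp with (H v :: v).
  - constructor; [auto|]. rewrite <- Hv. exact (evals_projections [] v).
  - induction (H v) as [|m IH]; simpl.
    + constructor. auto.
    + econstructor; [exact IH|]. apply Hg. simpl. lia.
Qed.

Lemma tc_cons n F G :
  total_computable (S n) F -> total_computable n G ->
  total_computable n (fun v => F (G v :: v)).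
Proof.
  intros [f Hf] [g Hg]. exists (PComp f (g :: map PProj (seq 0 n))). intros v Hv.
  apply ev_comp with (G v :: v).
  - constructor; [auto|]. rewrite <- Hv. exact (evals_projections [] v).
  - apply Hf. simpl. lia.
Qed.

Lemma tc_weaken n F k :
  total_computable n F -> total_computable (k + n) (fun v => F (skipn k v)).
Proof.
  intros [f Hf]. exists (PComp f (map PProj (seq k n))). intros v Hv.
  assert (Hl : length (skipn k v) = n) by (rewrite length_skipn; lia).
  apply ev_comp with (skipn k v); [|now apply Hf].
  pose proof (evals_projections (firstn k v) (skipn k v)) as He.
  rewrite firstn_skipn, length_firstn, Hl, Nat.min_l in He by lia. exact He.
Qed.

Lemma tc_pred n F : total_computable n F -> total_computable n (fun v => pred (F v)).
Proof.
  apply (tc_app1 pred).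
  eapply tc_ext; [apply (tc_rec 1 (fun _ => 0) (fun v => nth 0 v 0) (fun v => nth 0 v 0))|];
    [apply tc_const|apply tc_var; lia|apply tc_var; lia|].
  intros v _. cbn [nth]. now destruct (nth 0 v 0).
Qed.

Lemma tc_add n F G :
  total_computable n F -> total_computable n G -> total_computable n (fun v => F v + G v).
Proof.
  apply (tc_app2 Nat.add).
  eapply tc_ext; [apply (tc_rec 2 (fun v => nth 1 v 0) (fun v => S (nth 1 v 0))
    (fun v => nth 0 v 0))|];
    [apply tc_var; lia|apply tc_succ, tc_var; lia|apply tc_var; lia|].
  intros v _. cbn [nth]. induction (nth 0 v 0); simpl; congruence.
Qed.

Lemma tc_mul n F G :
  total_computable n F -> total_computable n G -> total_computable n (fun v => F v * G v).
Proof.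
  apply (tc_app2 Nat.mul).
  eapply tc_ext; [apply (tc_rec 2 (fun v => 0) (fun v => nth 3 v 0 + nth 1 v 0)
    (fun v => nth 0 v 0))|];
    [apply tc_const|apply tc_add; apply tc_var; lia|apply tc_var; lia|].
  intros v _. cbn [nth]. induction (nth 0 v 0); simpl; congruence.
Qed.

Lemma tc_sub n F G :
  total_computable n F -> total_computable n G -> total_computable n (fun v => F v - G v).
Proof.
  apply (tc_app2 Nat.sub).
  eapply tc_ext; [apply (tc_rec 2 (fun v => nth 0 v 0) (fun v => pred (nth 1 v 0))
    (fun v => nth 1 v 0))|];
    [apply tc_var; lia|apply tc_pred; apply tc_var; lia|apply tc_var; lia|].
  intros v _. cbn [nth]. induction (nth 1 v 0); simpl; lia.
Qed.

Lemma tc_pow2 n F : total_computable n F -> total_computable n (fun v => 2 ^ F v).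
Proof.
  apply (tc_app1 (Nat.pow 2)).
  eapply tc_ext; [apply (tc_rec 1 (fun v => 1) (fun v => 2 * nth 1 v 0) (fun v => nth 0 v 0))|];
    [apply tc_const|apply tc_mul; [apply tc_const|apply tc_var; lia]|apply tc_var; lia|].
  intros v _. cbn [nth]. induction (nth 0 v 0) as [|m IH]; [easy|].
  cbn [prim_rec]. rewrite IH. easy.
Qed.

Lemma tc_case n C F G :
  total_computable n C -> total_computable n F -> total_computable (S n) G ->
  total_computable n (fun v => match C v with 0 => F v | S m => G (m :: v) end).
Proof.
  intros HC HF HG.
  (* A case distinction is a recursion whose step ignores counter and accumulator and recomputes
     [pred (C v)]. *)
  eapply tc_ext;
    [apply (tc_rec n F (fun w => G (pred (C (skipn 2 w)) :: skipn 2 w)) C)|];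
    [easy| |easy|].
  - apply (tc_weaken n (fun v => G (pred (C v) :: v)) 2).
    apply (tc_cons n G (fun v => pred (C v))); [easy|]. now apply tc_pred.
  - intros v _. simpl. destruct (C v); easy.
Qed.

Lemma tc_ifz n C F G :
  total_computable n C -> total_computable n F -> total_computable n G ->
  total_computable n (fun v => match C v with 0 => F v | S _ => G v end).
Proof.
  intros HC HF HG. apply (tc_case n C F (fun w => G (skipn 1 w))); try easy.
  now apply (tc_weaken n G 1).
Qed.

Lemma tc_leb n A B F G :
  total_computable n A -> total_computable n B ->
  total_computable n F -> total_computable n G ->
  total_computable n (fun v => if A v <=? B v then F v else G v).
Proof.
  intros HA HB HF HG.
  eapply tc_ext; [apply (tc_ifz n (fun v => A v - B v) F G); try easy; now apply tc_sub|].
  intros v _. cbv beta. destruct (A v - B v) eqn:E, (Nat.leb_spec (A v) (B v)); lia.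
Qed.

Lemma tc_eqb n A B F G :
  total_computable n A -> total_computable n B ->
  total_computable n F -> total_computable n G ->
  total_computable n (fun v => if A v =? B v then F v else G v).
Proof.
  intros HA HB HF HG.
  eapply tc_ext; [apply (tc_ifz n (fun v => (A v - B v) + (B v - A v)) F G); try easy;
    apply tc_add; now apply tc_sub|].
  intros v _. cbv beta. destruct (A v - B v + (B v - A v)) eqn:E, (Nat.eqb_spec (A v) (B v)); lia.
Qed.

Ltac tc_step := first
  [ assumption | apply tc_const | (apply tc_var; simpl; lia) | apply tc_succ
  | apply tc_leb | apply tc_eqb | apply tc_pred | apply tc_add | apply tc_mul
  | apply tc_sub | apply tc_pow2 | apply tc_ifz ].

Ltac tc := repeat tc_step.

Fixpoint bsum (f : nat -> nat) (n : nat) : nat :=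
  match n with 0 => 0 | S m => bsum f m + f m end.

Lemma tc_bsum n F H :
  total_computable (S n) F -> total_computable n H ->
  total_computable n (fun v => bsum (fun i => F (i :: v)) (H v)).
Proof.
  intros HF HH.
  eapply tc_ext; [apply (tc_rec n (fun _ => 0)
     (fun w => nth 1 w 0 + F (nth 0 w 0 :: skipn 2 w)) H); try easy; tc|].
  - destruct HF as [f Hf]. exists (PComp f (PProj 0 :: map PProj (seq 2 n))).
    intros [|a [|b v]] Hv; try easy. simpl. apply ev_comp with (a :: v).
    + constructor; [apply (ev_proj 0 (a :: b :: v)); simpl; lia|].
      replace n with (length v) by (simpl in Hv; lia). exact (evals_projections [a; b] v).
    + apply Hf. simpl in *. lia.
  - intros v _. simpl. induction (H v); simpl; congruence.
Qed.

Lemma tc_log2 n F : total_computable n F -> total_computable n (fun v => Nat.log2 (S (F v))).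
Proof.
  apply (tc_app1 (fun m => Nat.log2 (S m))).
  (* The accumulator at i is [log2 (S i)]; it rises exactly when [S (S i)] is a power of two. *)
  eapply tc_ext; [apply (tc_rec 1 (fun v => 0)
    (fun v => if 2 ^ S (nth 1 v 0) <=? S (S (nth 0 v 0)) then S (nth 1 v 0) else nth 1 v 0)
      (fun v => nth 0 v 0))|];
    tc.
  intros v _. cbn [nth]. induction (nth 0 v 0) as [|m IH]; [easy|].
  cbn [prim_rec]. rewrite IH.
  destruct (Nat.log2_spec (S m) ltac:(lia)) as [H1 H2].
  destruct (Nat.leb_spec (2 ^ S (Nat.log2 (S m))) (S (S m))) as [H|H]; symmetry.
  - apply Nat.log2_unique; [lia|]. simpl in *. lia.
  - apply Nat.log2_unique; [lia|]. simpl in *. lia.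
Qed.

(* [F (s :: v)] is the value of [p] at [v] plus one if the evaluation ends within
   the search bound [s], and 0 otherwise. *)
Definition stages (n : nat) (p : prf) (F : list nat -> nat) : Prop :=
  total_computable (S n) F /\
  forall v, length v = n ->
    (forall s s' y, s <= s' -> F (s :: v) = S y -> F (s' :: v) = S y) /\
    (forall y, eval p v y <-> exists s, F (s :: v) = S y).

(** * Evaluation of programs in stages *)

Lemma stages_rec n f g Ff Fg :
  stages n f Ff -> stages (S (S n)) g Fg ->
  exists F, stages (S n) (PRec f g) F.
Proof.
  intros [Tf Hf] [Tg Hg].
  (* One bound [s] serves the base case and all unfoldings, and an unfinished value 0 is passed on.
     Since finished values persist, the bounds of several subevaluations can be merged by adding
     them. *)
  set (R := fun s v => prim_rec (Ff (s :: v))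
     (fun i (y : nat) => match y with 0 => 0 | S z => Fg (s :: i :: z :: v) end)).
  exists (fun w => R (nth 0 w 0) (skipn 2 w) (nth 1 w 0)). split.
  - eapply tc_ext; [apply (tc_rec (S (S n)) (fun w => Ff (nth 0 w 0 :: skipn 2 w))
      (fun w => match nth 1 w 0 with 0 => 0 | S _ => Fg (nth 2 w 0 :: nth 0 w 0 ::
        pred (nth 1 w 0) :: skipn 4 w) end) (fun w => nth 1 w 0))|].
    + destruct Tf as [q Hq]. exists (PComp q (PProj 0 :: map PProj (seq 2 n))).
      intros [|a [|b v]] Hv; try easy. simpl. apply ev_comp with (a :: v).
      * constructor; [apply (ev_proj 0 (a :: b :: v)); simpl; lia|].
        replace n with (length v) by (simpl in Hv; lia). exact (evals_projections [a; b] v).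
      * apply Hq. simpl in *. lia.
    + apply tc_ifz; tc.
      destruct Tg as [q Hq].
      destruct (tc_pred (S (S (S (S n)))) (fun w => nth 1 w 0) ltac:(tc)) as [r Hr].
      exists (PComp q (PProj 2 :: PProj 0 :: r :: map PProj (seq 4 n))).
      intros w Hv. destruct w as [|a [|b [|c [|d v]]]]; try easy.
      apply ev_comp with (c :: a :: pred b :: v).
      * constructor; [apply (ev_proj 2 (a :: b :: c :: d :: v)); simpl; lia|].
        constructor; [apply (ev_proj 0 (a :: b :: c :: d :: v)); simpl; lia|].
        constructor; [apply Hr, Hv|].
        replace n with (length v) by (simpl in Hv; lia).
        exact (evals_projections [a; b; c; d] v).
      * apply Hq. simpl in *. lia.
    + tc.
    + intros w Hw. destruct w as [|s [|m v]]; try easy. unfold R. simpl.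
      clear Hw. induction m as [|m IH]; simpl; [easy|]. rewrite IH. fold (R s v m);
        now destruct (R s v m).
  - assert (R0 : forall s v, R s v 0 = Ff (s :: v)) by easy.
    assert (RS : forall s v m, R s v (S m) =
      match R s v m with 0 => 0 | S z => Fg (s :: m :: z :: v) end) by easy.
    clearbody R.
    assert (Hmono : forall s s' v m y, length v = n -> s <= s' ->
      R s v m = S y -> R s' v m = S y).
    { intros s s' v m y Hv Hs. revert y.
      induction m as [|m IH]; intros y; [rewrite !R0|rewrite !RS].
      - now apply Hf.
      - destruct (R s v m) as [|z]; [easy|]. rewrite (IH _ eq_refl).
        apply Hg; simpl; lia. }
    intros [|m v] Hv; [easy|]. injection Hv as Hv. cbn [nth skipn].
    split; [intros; eapply Hmono; eauto|]. intros y; split.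
    + revert y. induction m as [|m IH]; intros y H; inversion H; subst.
      * match goal with H : eval f _ _ |- _ => apply (Hf v eq_refl) in H as [s Hs] end.
        exists s. now rewrite R0.
      * match goal with H : eval (PRec f g) (m :: v) ?z, H' : eval g _ _ |- _ =>
          destruct (IH _ H) as [s Hs]; apply Hg in H' as [s' Hs']; [|simpl; lia];
          exists (s + s'); rewrite RS, (Hmono s _ v m z) by (easy || lia);
          destruct (Hg (m :: z :: v)) as [Hm' _]; [simpl; lia|]
        end.
        apply Hm' with s'; [lia|easy].
    + intros [s Hs]. revert y Hs. induction m as [|m IH]; intros y Hy.
      * rewrite R0 in Hy. constructor. apply (Hf v Hv). eauto.
      * rewrite RS in Hy. destruct (R s v m) as [|z] eqn:E; [easy|].
        apply ev_recS with z; [now apply IH|]. apply Hg; [simpl; lia|]. eauto.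
Qed.

(** The bound limits both the number of candidates and each evaluation. An unfinished candidate must
    block the scan: skipping it could report a zero that a later stage would replace by a smaller
    one. *)
Lemma stages_min n f Ff :
  stages (S n) f Ff -> exists F, stages n (PMin f) F.
Proof.
  intros [Tf Hf].
  (* [scan] codes a search state: 0 = still searching, 1 = stuck on an
     evaluation not finished at stage [s], m + 2 = zero found at m. *)
  set (scan := fun s v => prim_rec 0
     (fun i (y : nat) => match y with
       | S _ => y
       | 0 => match Ff (s :: i :: v) with
              | 0 => 1
              | S z => match z with 0 => S (S i) | S _ => 0 end
              end
       end)).
  assert (scan0 : forall s v, scan s v 0 = 0) by easy.
  assert (scanS : forall s v t, scan s v (S t) =
    match scan s v t with
    | S _ => scan s v t
    | 0 => match Ff (s :: t :: v) with
           | 0 => 1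
           | S z => match z with 0 => S (S t) | S _ => 0 end
           end
    end) by easy.
  assert (H0 : forall s v t, scan s v t = 0 <-> forall i, i < t -> exists z, Ff (s :: i :: v)
    = S (S z)).
  { clearbody scan. intros s v t. induction t as [|t IH]; [rewrite scan0; split; [lia|easy]|].
    rewrite scanS. destruct (scan s v t) eqn:E.
    - destruct IH as [IH _]. split.
      + intros H i Hi. destruct (Nat.eq_dec i t) as [->|].
        * destruct (Ff (s :: t :: v)) as [|[|z]]; try easy. eauto.
        * apply IH; [easy|lia].
      + intros H. destruct (H t) as [z ->]; [lia|easy].
    - split; [easy|]. intros H. destruct IH as [_ IH]. apply IH. intros. apply H. lia. }
  assert (H2 : forall s v t m, scan s v t = S (S m) <->
     m < t /\ Ff (s :: m :: v) = 1 /\ forall i, i < m -> exists z, Ff (s :: i :: v) = S (S z)).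
  { clearbody scan. intros s v t m. induction t as [|t IH]; [rewrite scan0; split; [easy|lia]|].
    rewrite scanS. destruct (scan s v t) eqn:E.
    - assert (E' := proj1 (H0 _ _ _) E). split.
      + destruct (Ff (s :: t :: v)) as [|[|z]] eqn:E1; try easy.
        intros Hm. injection Hm as <-. auto.
      + intros (Hm & H1 & H). destruct (Nat.eq_dec m t) as [->|]; [now rewrite H1|].
        destruct (E' m) as [z Hz]; [lia|]. congruence.
    - rewrite IH. split; intros (Hm & H1 & H); [repeat split; auto; lia|].
      split; [|easy]. destruct (Nat.eq_dec m t) as [->|]; [|lia].
      apply H0 in H. congruence. }
  (* The predecessor merges the states 0 and 1 into 0 and turns m + 2 into m + 1, as [stages]
     requires. *)
  exists (fun w => pred (scan (nth 0 w 0) (skipn 1 w) (nth 0 w 0))). split.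
  - apply tc_pred.
    eapply tc_ext; [apply (tc_rec (S n) (fun w => 0)
      (fun w => match nth 1 w 0 with
         | S _ => nth 1 w 0
         | 0 => match Ff (nth 2 w 0 :: nth 0 w 0 :: skipn 3 w) with
           | 0 => 1
           | S _ => match pred (Ff (nth 2 w 0 :: nth 0 w 0 :: skipn 3 w)) with
              | 0 => S (S (nth 0 w 0)) | S _ => 0 end
           end
         end) (fun w => nth 0 w 0))|]; tc.
    1, 2: destruct Tf as [q Hq]; exists (PComp q (PProj 2 :: PProj 0 :: map PProj (seq 3 n)));
      intros w Hv; destruct w as [|a [|b [|c v]]]; try easy;
      apply ev_comp with (c :: a :: v);
      [ constructor; [apply (ev_proj 2 (a :: b :: c :: v)); simpl; lia|];
        constructor; [apply (ev_proj 0 (a :: b :: c :: v)); simpl; lia|];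
        replace n with (length v) by (simpl in Hv; lia);
        exact (evals_projections [a; b; c] v)
      | apply Hq; simpl in *; lia ].
    intros w Hw. destruct w as [|s v]; [easy|]. cbn [nth skipn].
    match goal with |- prim_rec ?a ?g s = _ =>
      enough (H : forall t, prim_rec a g t = scan s v t) by apply H end.
    clearbody scan. induction t as [|t IH]; cbn [prim_rec]; [now rewrite scan0|]. rewrite IH,
      scanS. cbn [nth skipn].
    destruct (scan s v t); [|easy]. now destruct (Ff (s :: t :: v)).
  - clearbody scan. intros v Hv. cbn [nth skipn].
    assert (HF : forall s m, pred (scan s v s) = S m <->
      m < s /\ Ff (s :: m :: v) = 1 /\ forall i, i < m -> exists z, Ff (s :: i :: v) = S (S z)).
    { intros s m. rewrite <- H2. lia. }
    assert (Hm : forall i s s' y, s <= s' -> Ff (s :: i :: v) = S y -> Ff (s' :: i :: v) = S y).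
    { intros i. apply Hf. simpl. lia. }
    split.
    + intros s s' y Hs. rewrite !HF. intros (Hy & H1 & H). repeat split.
      * lia.
      * now apply Hm with s.
      * intros i Hi. destruct (H i Hi) as [z Hz]. exists z. now apply Hm with s.
    + intros y. split.
      * intros H. inversion H; subst.
        match goal with H : eval f (y :: v) 0, H' : forall m, m < y -> _ |- _ =>
          rename H into Hy; rename H' into Hlt end.
        assert (exists s, forall i, i < y -> exists z, Ff (s :: i :: v) = S (S z)) as [s Hs].
        { clear H Hy. induction y as [|y IH]; [exists 0; lia|].
          destruct IH as [s Hs]; [intros; apply Hlt; lia|].
          destruct (Hlt y) as [k Hk]; [lia|].
          apply Hf in Hk; [|simpl; lia]. destruct Hk as [s' Hs'].
          exists (s + s'). intros i Hi. destruct (Nat.eq_dec i y) as [->|].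
          - exists k. apply Hm with s'; [lia|easy].
          - destruct (Hs i) as [z Hz]; [lia|]. exists z. apply Hm with s; [lia|easy]. }
        apply Hf in Hy; [|simpl; lia]. destruct Hy as [s' Hs'].
        exists (S y + s + s'). apply HF. repeat split.
        -- lia.
        -- apply Hm with s'; [lia|easy].
        -- intros i Hi. destruct (Hs i Hi) as [z Hz]. exists z. apply Hm with s; [lia|easy].
      * intros [s Hs]. apply HF in Hs. destruct Hs as (Hy & H1 & H).
        constructor.
        -- apply Hf; [simpl; lia|]. eauto.
        -- intros i Hi. destruct (H i Hi) as [z Hz]. exists z. apply Hf; [simpl; lia|]. eauto.
Qed.

Lemma stages_comp n f gs :
  (forall n, exists F, stages n f F) -> Forall (fun g => forall n, exists F, stages n g F) gs ->
  exists F, stages n (PComp f gs) F.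
Proof.
  intros Hf Hgs.
  assert (exists Gs, Forall2 (stages n) gs Gs) as [Gs HGs].
  { induction Hgs as [|g gs Hg _ [Gs IH]]; [exists []; constructor|].
    destruct (Hg n) as [G HG]. exists (G :: Gs). now constructor. }
  destruct (Hf (length Gs)) as [Ff [Tf Hff]].
  (* An unfinished argument is read as the default 0, so [ws] is meaningful only where [ok] is
     nonzero. *)
  set (ws := fun w : list nat => map (fun G : list nat -> nat => pred (G w)) Gs).
  set (ok := fun w => fold_right (fun (G : list nat -> nat) b => match G w with 0 => 0 |
    S _ => b end) 1 Gs).
  assert (Hok : forall s v, length v = n ->
     ok (s :: v) <> 0 -> evals gs v (ws (s :: v)) /\
      forall s', s <= s' -> ok (s' :: v) <> 0 /\ ws (s' :: v) = ws (s :: v)).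
  { intros s v Hv. subst ok ws. clear Tf Hff Hf Hgs.
    induction HGs as [|g G gs Gs HG _ IH]; simpl.
    - intros _. split; [constructor|]. intros. split; [lia|easy].
    - destruct (G (s :: v)) as [|y] eqn:E; [easy|]. intros H.
      destruct HG as [_ HG]. destruct (HG v Hv) as [HG1 HG2].
      destruct (IH H) as [IH1 IH2]. split.
      + constructor; [apply HG2; eauto|easy].
      + intros s' Hs. rewrite (HG1 _ _ _ Hs E). destruct (IH2 s' Hs) as [IH3 IH4].
        split; [easy|]. now rewrite IH4. }
  assert (Hex : forall v us, length v = n -> evals gs v us ->
     exists s, ok (s :: v) <> 0 /\ ws (s :: v) = us).
  { intros v us Hv. subst ok ws. clear Tf Hff Hf Hgs Hok.
    revert us. induction HGs as [|g G gs Gs HG HGs IH]; simpl; intros us Hus; inversion Hus; subst.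
    - exists 0. split; [lia|easy].
    - destruct HG as [_ HG]. destruct (HG v eq_refl) as [HG1 HG2].
      match goal with H : eval g _ _, H' : evals _ _ _ |- _ =>
        apply HG2 in H as [s Hs]; destruct (IH _ H') as (s' & H1 & H2) end.
      exists (s + s'). rewrite (HG1 s (s + s') w) by (easy || lia).
      clear - HGs H1 H2.
      revert ws H1 H2. induction HGs as [|g G' gs Gs' HG' _ IH]; simpl; intros us H1 H2.
      + subst. split; [lia|easy].
      + destruct (G' (s' :: v)) as [|z] eqn:E; [easy|].
        destruct HG' as [_ HG']. destruct (HG' v eq_refl) as [HG1 _].
        rewrite (HG1 s' (s + s') z) by (easy || lia). subst us.
        destruct (IH _ H1 eq_refl) as [H3 H4]. injection H4 as H4.
        split; [easy|]. simpl. now rewrite H4. }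
  exists (fun w => match ok w with 0 => 0 | S _ => Ff (nth 0 w 0 :: ws w) end). split.
  - apply tc_ifz; tc.
    + subst ok. clear - HGs. induction HGs as [|g G gs Gs [HG _] _ IH]; simpl; tc.
    + eapply tc_ext; [apply (tc_comp (S n) _ Ff ((fun w => nth 0 w 0) ::
        map (fun (G : list nat -> nat) w => pred (G w)) Gs) Tf)|].
      * simpl. now rewrite length_map.
      * constructor; [tc|]. clear - HGs. induction HGs as [|g G gs Gs [HG _] _ IH]; simpl;
          constructor; tc.
      * intros v _. simpl. now rewrite map_map.
  - intros v Hv. cbn [nth]. split.
    + intros s s' y Hs. destruct (ok (s :: v)) as [|b] eqn:E; [easy|].
      destruct (Hok s v Hv) as [_ H]; [lia|]. destruct (H s' Hs) as [H1 H2].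
      destruct (ok (s' :: v)); [easy|]. rewrite H2.
      apply Hff; [|easy]. unfold ws. now rewrite length_map.
    + intros y. split.
      * intros H. inversion H; subst.
        match goal with He : evals _ _ _, H' : eval f _ _ |- _ =>
          apply (Hex v _ eq_refl) in He as (s & H1 & <-);
          apply Hff in H' as [s' Hs']; [|unfold ws; now rewrite length_map] end.
        exists (s + s'). destruct (Hok s v eq_refl H1) as [_ H3].
        destruct (H3 (s + s')) as [H5 H6]; [lia|]. destruct (ok (s + s' :: v)); [easy|].
        rewrite H6. destruct (Hff (ws (s :: v))) as [Hm _]; [unfold ws; now rewrite length_map|].
        apply Hm with s'; [lia|easy].
      * intros [s Hs]. destruct (ok (s :: v)) as [|b] eqn:E; [easy|].
        destruct (Hok s v Hv) as [H _]; [lia|]. econstructor; [exact H|].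
        apply Hff; [unfold ws; now rewrite length_map|]. eauto.
Qed.

(** Takes the place of a universal machine. Where no rule of [eval] applies (a successor or a
    recursion at the empty vector, a projection out of range) the evaluator is constantly 0. *)
Lemma stages_exist p n : exists F, stages n p F.
Proof.
  revert n.
  induction p as [ | |i|f gs Hf Hgs|f g Hf Hg|f Hf] using prf_nested_ind; intros n.
  - exists (fun _ => 1). split; [tc|]. intros v _. split; [easy|]. intros y; split.
    + intros H; inversion H; subst. now exists 0.
    + intros [s H]. injection H as <-. constructor.
  - destruct n as [|n].
    + exists (fun _ => 0). split; [tc|]. intros [|x v]; [|easy]. intros _. split; [easy|].
      intros y; split; [intros H; inversion H|intros [s H]; easy].
    + exists (fun w => S (S (nth 1 w 0))). split; [tc|]. intros [|x v] Hv; [easy|]. split; [easy|].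
      intros y; split.
      * intros H; inversion H; subst. now exists 0.
      * intros [s H]. injection H as <-. constructor.
  - destruct (le_lt_dec n i) as [Hi|Hi].
    + exists (fun _ => 0). split; [tc|]. intros v Hv. split; [easy|].
      intros y; split; [intros H; inversion H; lia|intros [s H]; easy].
    + exists (fun w => S (nth (S i) w 0)). split; [tc|]. intros v Hv. split; [easy|].
      intros y; split.
      * intros H; inversion H; subst. now exists 0.
      * intros [s H]. injection H as <-. constructor. lia.
  - now apply stages_comp.
  - destruct n as [|n].
    + exists (fun _ => 0). split; [tc|]. intros [|x v]; [|easy]. intros _. split; [easy|].
      intros y; split; [intros H; inversion H|intros [s H]; easy].
    + destruct (Hf n) as [Ff HFf], (Hg (S (S n))) as [Fg HFg]. eapply stages_rec; eauto.
  - destruct (Hf (S n)) as [Ff HFf]. eapply stages_min; eauto.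
Qed.

(** Both values are found at some stage and persist to a common one. *)
Lemma eval_deterministic p v y z : eval p v y -> eval p v z -> y = z.
Proof.
  intros Hy Hz. destruct (stages_exist p (length v)) as [F [_ HF]].
  destruct (HF v eq_refl) as [Hm He]. apply He in Hy, Hz.
  destruct Hy as [s Hs], Hz as [t Ht].
  apply (Hm s (s + t)) in Hs; [|lia]. apply (Hm t (s + t)) in Ht; [|lia]. congruence.
Qed.

(** Which witness the search finds is left open; users have to know that [out] does not depend on
    it, or that only termination matters. *)
Lemma search_computable n R out :
  total_computable (S n) R -> total_computable 1 out ->
  exists p, forall v, length v = n ->
    (forall y, eval p v y -> exists e, R (e :: v) = 0 /\ y = out [e]) /\
    ((exists e, R (e :: v) = 0) -> exists y, eval p v y).
Proof.
  intros [r Hr] [o Ho]. exists (PComp o [PMin r]). intros v Hv. split.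
  - intros y H. inversion H as [| | |? ? ? ws ? Hws Hout| | |]; subst.
    inversion Hws as [|? ? ? w ? Hw Hnil]; subst. inversion Hnil; subst.
    inversion Hw as [| | | | | |? ? ? Hz _]; subst.
    exists w. split.
    + apply (eval_deterministic r (w :: v)); [apply Hr; simpl; lia|easy].
    + now apply (eval_deterministic o [w]); [|apply Ho].
  - intros [e He].
    destruct (dec_inh_nat_subset_has_unique_least_element (fun e => R (e :: v) = 0))
      as (m & [Hm Hl] & _);
      [intros k; destruct (Nat.eq_dec (R (k :: v)) 0); auto|eauto|].
    exists (out [m]). apply ev_comp with [m].
    + constructor; [|constructor]. constructor.
      * rewrite <- Hm. apply Hr. simpl. lia.
      * intros k Hk. exists (pred (R (k :: v))).
        destruct (R (k :: v)) as [|z] eqn:E; [apply Hl in E; lia|].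
        simpl. rewrite <- E. apply Hr. simpl. lia.
    + apply Ho. easy.
Qed.

(** * Binary strings as numbers *)

(** The binary expansion of [S (nat_of_str x)] is a leading 1 followed by x, so its logarithm is the
    length of x. *)
Definition slen (n : nat) : nat := Nat.log2 (S n).

Lemma nat_of_str_app p x :
  nat_of_str (p ++ x) = nat_of_str p * 2 ^ length x + nat_of_str x.
Proof.
  assert (H : forall x a, fold_left (fun n (b : bool) => 2 * n + 1 + (if b then 1 else 0)) x a
     = a * 2 ^ length x + nat_of_str x).
  { clear. induction x as [|b x IH]; intros a; unfold nat_of_str; cbn [fold_left length].
    - simpl. lia.
    - rewrite (IH (2 * a + _ + _)), (IH (2 * 0 + _ + _)), Nat.pow_succ_r'. lia. }
  unfold nat_of_str at 1. rewrite fold_left_app, H. easy.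
Qed.

Lemma nat_of_str_cons b x :
  nat_of_str (b :: x) = (if b then 2 else 1) * 2 ^ length x + nat_of_str x.
Proof. change (b :: x) with ([b] ++ x). rewrite nat_of_str_app. now destruct b.
Qed.

Lemma nat_of_str_bounds x : 2 ^ length x <= S (nat_of_str x) < 2 ^ S (length x).
Proof.
  induction x as [|b x IH]; [unfold nat_of_str; simpl; lia|].
  rewrite nat_of_str_cons. cbn [length]. rewrite !Nat.pow_succ_r' in *. destruct b; lia.
Qed.

Lemma slen_nat_of_str x : slen (nat_of_str x) = length x.
Proof. apply Nat.log2_unique; [lia|]. apply nat_of_str_bounds. Qed.

Lemma nat_of_str_inj x y : nat_of_str x = nat_of_str y -> x = y.
Proof.
  intros H. assert (Hl : length x = length y) by (now rewrite <- !slen_nat_of_str, H).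
  revert y H Hl. induction x as [|a x IH]; intros [|b y] H Hl; try easy.
  injection Hl as Hl. rewrite !nat_of_str_cons, Hl in H.
  pose proof (nat_of_str_bounds x) as Hx. pose proof (nat_of_str_bounds y) as Hy.
  rewrite Hl in Hx. rewrite Nat.pow_succ_r' in Hx, Hy.
  assert (a = b) as -> by (destruct a, b; lia). f_equal. apply IH; lia.
Qed.

Lemma nat_of_str_of_nat n : nat_of_str (str_of_nat n) = n.
Proof.
  assert (H : forall f n, n <= f -> nat_of_str (str_of_nat_aux f n) = n).
  { clear. induction f as [|f IH]; intros [|n] Hn; try easy.
    cbn [str_of_nat_aux pred].
    rewrite nat_of_str_app, IH by (pose proof (Nat.div2_decr n n); lia).
    rewrite Nat.odd_succ, <- Nat.negb_odd, Bool.negb_involutive.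
    pose proof (Nat.div2_odd n) as Ho.
    destruct (Nat.odd n); cbn in *; lia. }
  now apply H.
Qed.

Lemma str_of_nat_of_str x : str_of_nat (nat_of_str x) = x.
Proof. apply nat_of_str_inj, nat_of_str_of_nat. Qed.

Lemma tc_slen n F : total_computable n F -> total_computable n (fun v => slen (F v)).
Proof. apply tc_log2. Qed.

(* Decoded from [S e = 2 ^ (a + b) + a], as [a < 2 ^ (a + b)]. *)
Definition npair (a b : nat) : nat := 2 ^ (a + b) + a - 1.
Definition pfst (e : nat) : nat := S e - 2 ^ slen e.
Definition psnd (e : nat) : nat := slen e - pfst e.

Lemma slen_pair a b : slen (npair a b) = a + b.
Proof.
  unfold slen, npair. pose proof (Nat.pow_gt_lin_r 2 (a + b) ltac:(lia)).
  apply Nat.log2_unique; [lia|]. rewrite Nat.pow_succ_r'. lia.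
Qed.

Lemma pfst_pair a b : pfst (npair a b) = a.
Proof.
  unfold pfst. rewrite slen_pair. unfold npair.
  pose proof (Nat.pow_nonzero 2 (a + b) ltac:(lia)). lia.
Qed.

Lemma psnd_pair a b : psnd (npair a b) = b.
Proof. unfold psnd. rewrite slen_pair, pfst_pair. lia. Qed.

Lemma slen_le e : slen e <= e.
Proof.
  unfold slen. pose proof (Nat.log2_lt_lin (S e) ltac:(lia)). lia.
Qed.

Lemma psnd_le e : psnd e <= e.
Proof. unfold psnd. pose proof (slen_le e). lia. Qed.

Lemma pfst_le e : pfst e <= e.
Proof. unfold pfst. pose proof (Nat.pow_nonzero 2 (slen e) ltac:(lia)). lia. Qed.

Lemma tc_pair n F G : total_computable n F -> total_computable n G ->
  total_computable n (fun v => npair (F v) (G v)).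
Proof. intros. unfold npair. tc. Qed.

Lemma tc_pfst n F : total_computable n F -> total_computable n (fun v => pfst (F v)).
Proof. intros. unfold pfst, slen. tc; now apply tc_log2. Qed.

Lemma tc_psnd n F : total_computable n F -> total_computable n (fun v => psnd (F v)).
Proof. intros. unfold psnd, slen. tc; (now apply tc_log2) || now apply tc_pfst. Qed.

(** * Machines defined by search *)

Ltac tc_machine := repeat first
  [ match goal with
    | H : total_computable 1 (fun v => ?f _) |- _ => apply (tc_app1 f _ _ H)
    | H : total_computable 2 (fun v => ?f _ _) |- _ => apply (tc_app2 f _ _ _ H)
    end
  | apply tc_slen | apply tc_pair | apply tc_pfst | apply tc_psnd | tc_step ].

(** Turns a search into a function of type [str -> option str]. Such a function says whether the
    search ends, which is undecidable in general, so [T] is built with classical choice and then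
    matched with the program. *)
Lemma search_machine (R : nat -> nat -> nat) (out : nat -> nat) :
  total_computable 2 (fun v => R (nth 0 v 0) (nth 1 v 0)) ->
  total_computable 1 (fun v => out (nth 0 v 0)) ->
  (forall e e' z, R e z = 0 -> R e' z = 0 -> out e = out e') ->
  exists T : str -> option str, partial_computable T /\
    forall x y, T x = Some y <-> exists e, R e (nat_of_str x) = 0 /\ out e = nat_of_str y.
Proof.
  intros HR Hout Hf.
  destruct (search_computable 1 _ _ HR Hout) as [p Hp].
  set (T := fun x : str =>
    match excluded_middle_informative (exists e, R e (nat_of_str x) = 0) with
    | left H => Some (str_of_nat (out (proj1_sig (constructive_indefinite_description _ H))))
    | right _ => None
    end).
  assert (HT : forall x y, T x = Some y <->
     exists e, R e (nat_of_str x) = 0 /\ out e = nat_of_str y).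
  { intros x y. unfold T. destruct (excluded_middle_informative _) as [H|H].
    - destruct (constructive_indefinite_description _ H) as [e He]; simpl. split.
      + intros E. injection E as <-. exists e. now rewrite nat_of_str_of_nat.
      + intros (e' & He' & Ho). f_equal. rewrite (Hf _ _ _ He He'), Ho.
        apply str_of_nat_of_str.
    - split; [easy|]. intros (e & He & _). elim H. eauto. }
  exists T. split; [|exact HT]. exists p. intros x y. rewrite HT.
  destruct (Hp [nat_of_str x] eq_refl) as [H1 H2]. cbn [nth] in *. split.
  - intros H. destruct (H1 _ H) as (e & He & ->). eauto.
  - intros (e & He & <-). destruct H2 as [z Hz]; [eauto|].
    destruct (H1 _ Hz) as (e' & He' & ->). now rewrite (Hf _ _ _ He He').
Qed.

Lemma machine_stages U :
  partial_computable U ->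
  exists E : nat -> nat -> nat,
    total_computable 2 (fun v => E (nth 0 v 0) (nth 1 v 0)) /\
    (forall s s' p x, s <= s' -> E s p = S x -> E s' p = S x) /\
    (forall p x, U p = Some x <-> exists s, E s (nat_of_str p) = S (nat_of_str x)).
Proof.
  intros [q Hq]. destruct (stages_exist q 1) as [F [TF HF]].
  exists (fun s p => F [s; p]). split; [|split].
  - eapply tc_ext; [exact TF|]. intros v Hv. destruct v as [|a [|b [|c v]]]; easy.
  - intros s s' p x. apply (HF [p] eq_refl).
  - intros p x. rewrite <- Hq. apply (HF [nat_of_str p] eq_refl).
Qed.

(** * Kraft's inequality *)

Section RealSums.
Open Scope R_scope.

(** * Finite sums of real numbers *)

Definition rsum {A} (f : A -> R) (l : list A) : R := fold_right (fun a r => f a + r) 0 l.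

Lemma rsum_app {A} (f : A -> R) l l' : rsum f (l ++ l') = rsum f l + rsum f l'.
Proof. induction l; simpl; [lra|]. rewrite IHl. lra. Qed.

Lemma rsum_nonneg {A} (f : A -> R) l : (forall a, 0 <= f a) -> 0 <= rsum f l.
Proof. intros H. induction l as [|a l IH]; simpl; [lra|]. specialize (H a). lra. Qed.

Lemma rsum_le {A} (f g : A -> R) l :
  (forall a, In a l -> f a <= g a) -> rsum f l <= rsum g l.
Proof.
  induction l as [|a l IH]; simpl; intros H; [lra|].
  assert (f a <= g a) by auto. assert (rsum f l <= rsum g l) by auto. lra.
Qed.

Lemma rsum_ext {A} (f g : A -> R) l :
  (forall a, In a l -> f a = g a) -> rsum f l = rsum g l.
Proof. intros H. apply Rle_antisym; apply rsum_le; intros; rewrite H; lra || easy. Qed.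

Lemma rsum_map {A B} (f : B -> R) (g : A -> B) l : rsum f (map g l) = rsum (fun a => f (g a)) l.
Proof. induction l; simpl; congruence. Qed.

Lemma rsum_const {A} c (l : list A) : rsum (fun _ => c) l = INR (length l) * c.
Proof.
  induction l as [|a l IH]; [simpl; lra|]. cbn [length rsum fold_right].
  fold (rsum (fun _ : A => c) l). rewrite IH, S_INR. lra.
Qed.

Lemma rsum_plus {A} (f g : A -> R) l : rsum (fun a => f a + g a) l = rsum f l + rsum g l.
Proof. induction l; simpl; [lra|]. rewrite IHl. lra. Qed.

Lemma rsum_swap {A B} (f : A -> B -> R) l l' :
  rsum (fun a => rsum (f a) l') l = rsum (fun b => rsum (fun a => f a b) l) l'.
Proof.
  induction l as [|a l IH]; simpl.
  - rewrite rsum_const. lra.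
  - rewrite IH. symmetry. apply rsum_plus.
Qed.

Lemma rsum_filter {A} (f : A -> R) (t : A -> bool) l :
  rsum f (filter t l) = rsum (fun a => if t a then f a else 0) l.
Proof. induction l as [|a l IH]; simpl; [easy|]. destruct (t a); simpl; lra. Qed.

Lemma rsum_list_prod {A B} (f : A * B -> R) l l' :
  rsum f (list_prod l l') = rsum (fun a => rsum (fun b => f (a, b)) l') l.
Proof.
  induction l as [|a l IH]; simpl; [easy|]. now rewrite rsum_app, rsum_map, IH.
Qed.

Lemma rsum_incl {A} (f : A -> R) l l' :
  (forall a, 0 <= f a) -> NoDup l -> incl l l' -> rsum f l <= rsum f l'.
Proof.
  intros Hf Hn. revert l'. induction Hn as [|a l Ha Hn IH]; intros l' Hi.
  - now apply rsum_nonneg.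
  - destruct (in_split a l') as (l1 & l2 & ->); [apply Hi; now left|].
    assert (H : rsum f l <= rsum f (l1 ++ l2)).
    { apply IH. intros b Hb. specialize (Hi b (or_intror Hb)).
      apply in_app_or in Hi. apply in_or_app. destruct Hi as [|[->|]]; auto. easy. }
    rewrite rsum_app in *. simpl. lra.
Qed.

Lemma pow_half_pos n : 0 < (/ 2) ^ n.
Proof. apply pow_lt. lra. Qed.

Lemma pow_half_le n m : (n <= m)%nat -> (/ 2) ^ m <= (/ 2) ^ n.
Proof.
  intros H. replace m with (n + (m - n))%nat by lia. rewrite pow_add.
  assert ((/ 2) ^ (m - n) <= 1).
  { rewrite <- (pow1 (m - n)). apply pow_incr. lra. }
  pose proof (pow_half_pos n). nra.
Qed.

Lemma pow_half_inv n : (/ 2) ^ n * 2 ^ n = 1.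
Proof. rewrite <- Rpow_mult_distr. replace (/ 2 * 2) with 1 by lra. apply pow1. Qed.

Lemma INR_pow2 n : INR (2 ^ n) = 2 ^ n.
Proof. rewrite pow_INR. easy. Qed.

(** * Weights and dyadic intervals of strings *)

Definition weight (p : str) : R := (/ 2) ^ length p.

Definition prefix_free (P : str -> Prop) : Prop :=
  forall y y', P y -> P y' -> is_prefix y y' -> y = y'.

(** Induction on a bound for the lengths. If the empty string occurs, it is the only element;
    otherwise split by the first bit, whose removal keeps each half prefix-free and doubles its
    weight. *)
Lemma kraft (l : list str) :
  NoDup l -> prefix_free (fun y => In y l) -> rsum weight l <= 1.
Proof.
  assert (H : forall N l, (forall y, In y l -> (length y < N)%nat) ->
    NoDup l -> prefix_free (fun y => In y l) -> rsum weight l <= 1).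
  { clear. induction N as [|N IH]; intros l HN Hd Hp.
    - destruct l as [|y l]; [simpl; lra|]. specialize (HN y (or_introl eq_refl)). lia.
    - destruct (classic (In [] l)) as [Hnil|Hnil].
      + apply Rle_trans with (rsum weight [[]]); [|unfold weight; simpl; lra].
        apply rsum_incl; [intros; apply Rlt_le, pow_half_pos|easy|].
        intros y Hy. left. apply Hp; [easy|easy|]. now exists y.
      + set (tails := fun b : bool => flat_map (fun y => match y with
            | c :: r => if Bool.eqb c b then [r] else [] | [] => [] end) l).
        assert (Hin : forall b r, In r (tails b) <-> In (b :: r) l).
        { intros b r. unfold tails. rewrite in_flat_map. split.
          - intros ([|c y] & Hy & Hr); [easy|]. destruct (Bool.eqb_spec c b) as [->|]; [|easy].
            destruct Hr as [->|[]]. easy.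
          - intros Hr. exists (b :: r). split; [easy|]. rewrite Bool.eqb_reflx. now left. }
        assert (Hle : forall b, rsum weight (tails b) <= 1).
        { intros b. apply IH.
          - intros y Hy. apply Hin, HN in Hy. simpl in Hy. lia.
          - clear - Hd. unfold tails. induction Hd as [|y l Hy Hd IH]; simpl; [constructor|].
            destruct y as [|c r]; [easy|]. destruct (Bool.eqb_spec c b) as [->|]; [|easy].
            simpl. constructor; [|easy]. intros H. apply in_flat_map in H as ([|c y] & Hy' & Hr);
              [easy|].
            destruct (Bool.eqb_spec c b) as [->|]; [|easy]. now destruct Hr as [->|[]].
          - intros y y' Hy Hy' [z ->]. rewrite !Hin in *.
            enough (E : b :: y = b :: y ++ z) by (now injection E).
            apply Hp; [easy|easy|]. now exists z. }
        assert (E : rsum weight l = / 2 * (rsum weight (tails true) + rsum weight (tails false))).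
        { clear - Hnil. unfold tails. induction l as [|y l IH]; simpl; [lra|].
          rewrite !rsum_app, IH by (intros H; apply Hnil; now right).
          destruct y as [|[|] r]; [elim Hnil; now left| |]; unfold weight; simpl; lra. }
        pose proof (Hle true). pose proof (Hle false). lra. }
  intros Hd Hp. apply (H (S (list_max (map (@length bool) l)))); try easy.
  intros y Hy. apply Nat.lt_succ_r.
  pose proof (proj1 (list_max_le (map (@length bool) l) _) (Nat.le_refl _)) as Hm.
  rewrite Forall_forall in Hm. apply Hm. now apply in_map.
Qed.

(* Strings are read as dyadic subintervals of the unit interval. *)
Fixpoint left_end (q : str) : R :=
  match q with [] => 0 | b :: r => / 2 * ((if b : bool then 1 else 0) + left_end r) end.

Lemma left_end_bounds q : 0 <= left_end q /\ left_end q + weight q <= 1.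
Proof.
  unfold weight. induction q as [|b r IH]; simpl; [lra|]. destruct b; lra.
Qed.

Lemma left_end_app q r : left_end (q ++ r) = left_end q + weight q * left_end r.
Proof.
  unfold weight. induction q as [|b q IH]; simpl; [lra|]. rewrite IH. destruct b; lra.
Qed.

Lemma weight_app q r : weight (q ++ r) = weight q * weight r.
Proof. unfold weight. now rewrite length_app, pow_add. Qed.

Lemma left_end_prefix q q' : is_prefix q q' ->
  left_end q <= left_end q' /\ left_end q' + weight q' <= left_end q + weight q.
Proof.
  intros [r ->]. rewrite left_end_app, weight_app. destruct (left_end_bounds r).
  pose proof (pow_half_pos (length q)) as Hq. fold (weight q) in Hq. nra.
Qed.

(** The natural number is q read as a plain binary numeral, that is, the index of its interval in
    the grid of step [weight q]. This makes comparisons of endpoints computable. *)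
Lemma left_end_code q :
  left_end q = INR (S (nat_of_str q) - 2 ^ length q) * weight q.
Proof.
  rewrite minus_INR by apply nat_of_str_bounds. rewrite S_INR, INR_pow2.
  induction q as [|b r IH].
  - unfold weight. simpl. lra.
  - rewrite nat_of_str_cons, plus_INR, mult_INR, INR_pow2. cbn [left_end]. rewrite IH.
    unfold weight. cbn [length pow]. pose proof (pow_half_inv (length r)) as H.
    assert (H' : (if b then 1 else 0) = (if b then 1 else 0) * ((/ 2) ^ length r * 2 ^ length r))
      by (rewrite H; lra).
    rewrite H'. destruct b; simpl; lra.
Qed.

End RealSums.

(** * Prefix-free complexity *)

Definition prefix_complexity (U : str -> option str) (x : str) : nat :=
  epsilon (inhabits 0) (C_is U x).

Lemma C_is_exists T y x : T y = Some x -> exists k, C_is T x k /\ k <= length y.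
Proof.
  intros Hy.
  destruct (dec_inh_nat_subset_has_unique_least_element
     (fun k => exists y, T y = Some x /\ length y = k)) as (k & [Hk Hl] & _).
  - intros k. apply classic.
  - eauto.
  - exists k. split; [split; [easy|]|].
    + intros y' Hy'. apply Hl. eauto.
    + apply Hl. eauto.
Qed.

Lemma C_is_unique T x k k' : C_is T x k -> C_is T x k' -> k = k'.
Proof.
  intros [(y & Hy & <-) H] [(y' & Hy' & <-) H'].
  specialize (H y' Hy'). specialize (H' y Hy). lia.
Qed.

Section PrefixComplexity.
Context (U : str -> option str) (HU : optimal_prefix_free U).

Notation K := (prefix_complexity U).

(** Optimality against this machine shows that every string has a program for [U]. The test accepts
    only the number 0, which codes the empty string. *)
Lemma constant_machine x : exists T, prefix_free_machine T /\ T [] = Some x.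
Proof.
  destruct (search_machine (fun _ z => z) (fun _ => nat_of_str x)) as (T & HT & H); tc_machine;
    [easy|].
  assert (H0 : forall y z, T y = Some z -> y = []).
  { intros y z Hy. apply H in Hy as (_ & Hy & _). now apply nat_of_str_inj. }
  exists T. repeat split.
  - easy.
  - intros y y' Hy Hy' _. destruct (T y) eqn:E, (T y') eqn:E'; try easy.
    apply H0 in E, E'. congruence.
  - apply H. exists 0. easy.
Qed.

Lemma K_spec x : C_is U x (K x).
Proof.
  apply (epsilon_spec (inhabits 0) (C_is U x)). destruct (constant_machine x) as (T & HT & H).
  destruct (proj2 HU T HT) as [c Hc]. destruct (C_is_exists _ _ _ H) as (k & Hk & _).
  destruct (Hc _ _ Hk) as (k' & Hk' & _). eauto.
Qed.

Lemma K_program x : exists p, U p = Some x /\ length p = K x.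
Proof. apply K_spec. Qed.

Lemma K_le_length p x : U p = Some x -> K x <= length p.
Proof. apply K_spec. Qed.

Lemma K_le_machine T : prefix_free_machine T ->
  exists c, forall y x, T y = Some x -> K x <= length y + c.
Proof.
  intros HT. destruct (proj2 HU T HT) as [c Hc]. exists c. intros y x Hy.
  destruct (C_is_exists _ _ _ Hy) as (k & Hk & Hle).
  destruct (Hc _ _ Hk) as (k' & Hk' & Hle').
  rewrite (C_is_unique _ _ _ _ (K_spec x) Hk'). lia.
Qed.

Lemma domain_prefix_free : prefix_free (fun y => U y <> None).
Proof. intros y y'. apply HU. Qed.

(** Applying [f] after [U] only shrinks the domain, so the composite is still a prefix-free
    machine. *)
Lemma K_map_le f : partial_computable f ->
  exists c, forall x y, f x = Some y -> K y <= K x + c.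
Proof.
  intros [pf Hf]. destruct (proj1 HU) as [[pU HpU] Hpre].
  set (T := fun z => match U z with Some x => f x | None => None end).
  destruct (K_le_machine T) as [c Hc].
  - split.
    + exists (PComp pf [pU]). intros z y. unfold T. split.
      * intros H. inversion H as [| | |? ? ? ws ? Hws Hev| | |]; subst.
        inversion Hws as [|? ? ? w ? Hw Hnil]; subst. inversion Hnil; subst.
        rewrite <- (nat_of_str_of_nat w) in Hw, Hev. apply HpU in Hw. rewrite Hw.
        now apply Hf.
      * destruct (U z) as [x|] eqn:E; [|easy]. intros H.
        apply ev_comp with [nat_of_str x].
        -- constructor; [now apply HpU|constructor].
        -- now apply Hf.
    + intros y y' Hy Hy'. unfold T in *. apply Hpre; [destruct (U y)|destruct (U y')]; easy.
  - exists c. intros x y Hxy. destruct (K_program x) as (p & Hp & <-).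
    apply Hc. unfold T. now rewrite Hp.
Qed.

Lemma tc_partial (g : nat -> nat) :
  total_computable 1 (fun v => g (nth 0 v 0)) ->
  partial_computable (fun x => Some (str_of_nat (g (nat_of_str x)))).
Proof.
  intros [p Hp]. exists p. intros x y. specialize (Hp [nat_of_str x] eq_refl). cbn [nth] in Hp.
    split.
  - intros H. rewrite (eval_deterministic _ _ _ _ Hp H). now rewrite str_of_nat_of_str.
  - intros H. injection H as <-. now rewrite nat_of_str_of_nat.
Qed.

Lemma K_length_le : exists c, forall x, K (str_of_nat (length x)) <= K x + c.
Proof.
  destruct (K_map_le _ (tc_partial slen ltac:(tc_machine))) as [c Hc]. exists c. intros x.
  rewrite <- slen_nat_of_str. now apply Hc.
Qed.

(* Requests are served in order by consecutive intervals of the unit interval;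
   a program for request [e] is a dyadic interval of half its length lying inside. *)
Lemma kraft_chaitin (req kap out : nat -> nat) :
  total_computable 1 (fun v => req (nth 0 v 0)) ->
  total_computable 1 (fun v => kap (nth 0 v 0)) ->
  total_computable 1 (fun v => out (nth 0 v 0)) ->
  (forall e, kap e <= e) ->
  (forall N, rsum (fun e => (/ 2) ^ kap e)%R (filter (fun e => req e =? 0) (seq 0 N)) <= 1)%R ->
  exists c, forall e, req e = 0 -> K (str_of_nat (out e)) <= kap e + c.
Proof.
  intros Hreq Hkap Hout Hke Hsum.
  (* [X e] is 2 ^ (e + 1) times the total length of the requests before [e]. *)
  set (X := prim_rec 0 (fun e x => 2 * (x + if req e =? 0 then 2 ^ (S e - kap e) else 0))).
  set (sigma := fun N => rsum (fun e => (/ 2) ^ kap e)%R (filter (fun e => req e =? 0) (seq 0 N))).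
  assert (HX : total_computable 1 (fun v => X (nth 0 v 0))).
  { apply (tc_rec 1 (fun _ => 0) (fun w => 2 * (nth 1 w 0 +
      if req (nth 0 w 0) =? 0 then 2 ^ (S (nth 0 w 0) - kap (nth 0 w 0)) else 0))); tc_machine. }
  assert (HsigS : forall e, sigma (S e) = (sigma e + if req e =? 0 then (/ 2) ^ kap e else 0)%R).
  { intros e. unfold sigma. rewrite seq_S, filter_app, rsum_app. simpl.
    destruct (req e =? 0); simpl; lra. }
  assert (HXsig : forall e, INR (X e) = (sigma e * 2 ^ S e)%R).
  { induction e as [|e IH]; [unfold sigma; simpl; lra|].
    rewrite HsigS. change (X (S e)) with (2 * (X e + if req e =? 0 then 2 ^ (S e - kap e) else 0)).
    rewrite mult_INR, plus_INR, IH. destruct (req e =? 0); [|simpl; lra].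
    (* The subtraction is not truncated, because [kap e <= e]. *)
    rewrite INR_pow2. replace (2 ^ S (S e))%R with (2 * (2 ^ kap e * 2 ^ (S e - kap e)))%R.
    2: { rewrite <- pow_add. specialize (Hke e). replace (kap e + (S e - kap e)) with (S e)
      by lia. easy. }
    pose proof (pow_half_inv (kap e)) as Hi.
    replace (2 ^ S e)%R with (2 ^ kap e * 2 ^ (S e - kap e))%R.
    2: { rewrite <- pow_add. specialize (Hke e). f_equal. lia. }
    simpl (INR 2).
    transitivity (2 * (sigma e * (2 ^ kap e * 2 ^ (S e - kap e))) +
       2 * (2 ^ (S e - kap e) * ((/ 2) ^ kap e * 2 ^ kap e)))%R; [rewrite Hi; lra|lra]. }
  assert (Hsmono : forall e e', e <= e' -> (sigma e <= sigma e')%R).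
  { induction 1 as [|e' _ IH]; [lra|]. rewrite HsigS. pose proof (pow_half_pos (kap e')).
    destruct (req e' =? 0); lra. }
  (* The two real inequalities of [HR], multiplied by 2 ^ (e + 1): the grid step [weight q] becomes
     2 ^ (e - kap e). Starting less than one step after [sigma e], the interval of q ends within two
     steps, hence by [sigma (S e)]. *)
  set (R := fun e z => if req e =? 0 then if slen z =? S (kap e) then
      if X e <=? (S z - 2 ^ slen z) * 2 ^ (e - kap e) then
      if S ((S z - 2 ^ slen z) * 2 ^ (e - kap e)) <=? X e + 2 ^ (e - kap e) then 0 else 1 else
        1 else 1 else 1).
  assert (HR : forall e q, R e (nat_of_str q) = 0 <-> req e = 0 /\ length q = S (kap e) /\
     (sigma e <= left_end q)%R /\ (left_end q < sigma e + weight q)%R).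
  { intros e q. unfold R. rewrite slen_nat_of_str.
    set (a := S (nat_of_str q) - 2 ^ length q).
    assert (Hcmp : length q = S (kap e) ->
       (INR (a * 2 ^ (e - kap e)) = left_end q * 2 ^ S e /\
        INR (2 ^ (e - kap e)) = weight q * 2 ^ S e)%R).
    { intros Hl. rewrite mult_INR, INR_pow2, left_end_code. fold a.
      assert (E : (2 ^ (e - kap e) = weight q * 2 ^ S e)%R).
      { unfold weight. rewrite Hl. replace (S e) with (S (kap e) + (e - kap e))
        by (specialize (Hke e); lia).
        rewrite pow_add, <- Rmult_assoc, pow_half_inv. lra. }
      rewrite E. lra. }
    pose proof (pow_lt 2 (S e) ltac:(lra)) as Hpos.
    destruct (Nat.eqb_spec (req e) 0) as [H0|H0]; [|split; [easy|lia]].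
    destruct (Nat.eqb_spec (length q) (S (kap e))) as [Hl|Hl]; [|split; [easy|lia]].
    destruct (Hcmp Hl) as [E1 E2]. specialize (HXsig e).
    assert (C1 : X e <= a * 2 ^ (e - kap e) <-> (sigma e <= left_end q)%R).
    { split; intros H.
      - apply le_INR in H. rewrite E1, HXsig in H. now apply Rmult_le_reg_r in H.
      - apply INR_le. rewrite E1, HXsig. apply Rmult_le_compat_r; lra. }
    assert (C2 : a * 2 ^ (e - kap e) < X e + 2 ^ (e - kap e) <->
      (left_end q < sigma e + weight q)%R).
    { split; intros H.
      - apply lt_INR in H. rewrite plus_INR, E1, E2, HXsig in H. nra.
      - apply INR_lt. rewrite plus_INR, E1, E2, HXsig. nra. }
    destruct (Nat.leb_spec (X e) (a * 2 ^ (e - kap e))) as [H1|H1];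
      [destruct (Nat.leb_spec (S (a * 2 ^ (e - kap e))) (X e + 2 ^ (e - kap e))) as [H2|H2]|].
    - split; [|easy]. intros _. repeat split; try easy; [now apply C1|now apply C2].
    - split; [easy|]. intros (_ & _ & _ & H). apply C2 in H. lia.
    - split; [easy|]. intros (_ & _ & H & _). apply C1 in H. lia. }
  assert (Hinside : forall e q, R e (nat_of_str q) = 0 ->
     (sigma e <= left_end q /\ left_end q + weight q <= sigma (S e))%R).
  { intros e q H. apply HR in H as (H0 & Hl & H1 & H2). split; [easy|].
    rewrite HsigS, H0. simpl. unfold weight in *. rewrite Hl in *. simpl in *. lra. }
  (* Prefixes give nested intervals, whereas distinct requests own disjoint ones. *)
  assert (Huniq : forall e e' q q', R e (nat_of_str q) = 0 -> R e' (nat_of_str q') = 0 ->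
     is_prefix q q' -> e = e').
  { intros e e' q q' H H' Hp. apply Hinside in H, H'. apply left_end_prefix in Hp.
    pose proof (pow_half_pos (length q')) as Hq. fold (weight q') in Hq.
    destruct (Nat.lt_trichotomy e e') as [Hlt|[E|Hlt]]; [|easy|].
    - specialize (Hsmono (S e) e' Hlt). lra.
    - specialize (Hsmono (S e') e Hlt). lra. }
  destruct (search_machine R out) as (T & HT & HTs).
  - unfold R. tc_machine.
  - easy.
  - intros e e' z H H'. f_equal. rewrite <- (nat_of_str_of_nat z) in H, H'.
    apply (Huniq e e' _ _ H H'). exists []. now rewrite app_nil_r.
  - destruct (K_le_machine T) as [c Hc].
    + split; [easy|]. intros y y' Hy Hy' Hp.
      destruct (T y) as [x|] eqn:E; [|easy]. destruct (T y') as [x'|] eqn:E'; [|easy].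
      apply HTs in E as (e & He & _). apply HTs in E' as (e' & He' & _).
      assert (e = e') as <- by (eapply Huniq; eauto).
      apply HR in He, He'. destruct Hp as [r ->]. destruct r as [|b r]; [now rewrite app_nil_r|].
      destruct He as (_ & He & _), He' as (_ & He' & _). rewrite length_app in He'. simpl in He'.
        lia.
    (* The successor pays for the program length [S (kap e)]. *)
    + exists (S c). intros e He.
      (* the least multiple of the grid step above [sigma e] *)
      assert (exists a, X e <= a * 2 ^ (e - kap e) < X e + 2 ^ (e - kap e)) as [a Ha].
      { pose proof (Nat.pow_nonzero 2 (e - kap e) ltac:(lia)) as Hd.
        generalize dependent (2 ^ (e - kap e)). intros d Hd. exists ((X e + d - 1) / d).
        pose proof (Nat.div_mod (X e + d - 1) d Hd).
          pose proof (Nat.mod_upper_bound (X e + d - 1) d Hd).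
        nia. }
      (* The bound on the total length enters here: the chosen interval ends by [sigma (S e)], hence
         by 1, so [a] is the index of a string of length [S (kap e)]. *)
      assert (Ha2 : a < 2 ^ S (kap e)).
      { apply INR_lt. rewrite INR_pow2.
        assert (H : (INR (S a * 2 ^ (e - kap e)) <= 2 ^ S e)%R).
        { apply Rle_trans with (INR (X e + 2 * 2 ^ (e - kap e))); [apply le_INR; lia|].
          rewrite plus_INR, mult_INR, HXsig, INR_pow2. simpl (INR 2).
          specialize (Hsum (S e)). fold (sigma (S e)) in Hsum.
          rewrite HsigS, He in Hsum. cbn [Nat.eqb] in Hsum.
          assert (E : (2 * 2 ^ (e - kap e) = (/ 2) ^ kap e * 2 ^ S e)%R).
          { replace (S e) with (kap e + S (e - kap e)) by (specialize (Hke e); lia).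
            rewrite pow_add, <- Rmult_assoc, pow_half_inv. simpl. lra. }
          change (1 + 1)%R with 2%R. rewrite E, <- Rmult_plus_distr_r.
          rewrite <- (Rmult_1_l (2 ^ S e)) at 2.
          apply Rmult_le_compat_r; [apply pow_le; lra|exact Hsum]. }
        rewrite mult_INR, S_INR, INR_pow2 in H.
        replace (S e) with (S (kap e) + (e - kap e)) in H by (specialize (Hke e); lia).
        rewrite pow_add in H. pose proof (pow_lt 2 (e - kap e) ltac:(lra)). nra. }
      set (q := str_of_nat (2 ^ S (kap e) + a - 1)).
      assert (Hq : nat_of_str q = 2 ^ S (kap e) + a - 1) by apply nat_of_str_of_nat.
      assert (Hl : length q = S (kap e)).
      { rewrite <- slen_nat_of_str, Hq. apply Nat.log2_unique; [lia|].
        pose proof (Nat.pow_nonzero 2 (S (kap e)) ltac:(lia)). rewrite (Nat.pow_succ_r' 2 (S _)).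
        clear Hq q. generalize dependent (2 ^ S (kap e)). intros. lia. }
      rewrite Nat.add_succ_r. rewrite <- Nat.add_succ_l, <- Hl. apply Hc. apply HTs. exists e.
      rewrite nat_of_str_of_nat. split; [|easy].
      unfold R. rewrite slen_nat_of_str, He, Hl, !Nat.eqb_refl, Hq.
      pose proof (Nat.pow_nonzero 2 (S (kap e)) ltac:(lia)).
      replace (S (2 ^ S (kap e) + a - 1) - 2 ^ S (kap e)) with a by lia.
      destruct (Nat.leb_spec (X e) (a * 2 ^ (e - kap e))); [|lia].
      destruct (Nat.leb_spec (S (a * 2 ^ (e - kap e))) (X e + 2 ^ (e - kap e))); lia.
Qed.

End PrefixComplexity.

(** * Complexity of strings of a given length *)

Lemma prefix_comparable (p x p' x' : str) :
  p ++ x = p' ++ x' -> is_prefix p p' \/ is_prefix p' p.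
Proof.
  intros H. apply app_eq_app in H as [l [[-> _]|[-> _]]]; [right|left]; now exists l.
Qed.

Section SlowComplexity.
Context (U : str -> option str) (HU : optimal_prefix_free U).
Context (E : nat -> nat -> nat)
  (HE : total_computable 2 (fun v => E (nth 0 v 0) (nth 1 v 0)))
  (Emono : forall s s' p x, s <= s' -> E s p = S x -> E s' p = S x)
  (HEU : forall p x, U p = Some x <-> exists s, E s (nat_of_str p) = S (nat_of_str x)).

Notation K := (prefix_complexity U).

Lemma E_output s p x : E s p = S x -> U (str_of_nat p) = Some (str_of_nat x).
Proof. intros H. apply HEU. exists s. now rewrite !nat_of_str_of_nat. Qed.

Lemma domain_comparable p p' y y' : U p = Some y -> U p' = Some y' ->
  is_prefix p p' \/ is_prefix p' p -> p = p'.
Proof.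
  intros H H' [Hp|Hp]; [|symmetry]; apply (domain_prefix_free U HU); congruence.
Qed.

(** The machine reads a program p of [U] for the length of x, then x itself. As p announces how many
    bits follow, the domain stays prefix-free. *)
Lemma K_le_length_add : exists c, forall x,
  K x <= length x + K (str_of_nat (length x)) + c.
Proof.
  (* Here e codes p, x and a stage at which p has produced the length of x. *)
  set (R := fun e z =>
    if pfst e * 2 ^ slen (pfst (psnd e)) + pfst (psnd e) =? z then
    if E (psnd (psnd e)) (pfst e) =? S (slen (pfst (psnd e))) then 0 else 1 else 1).
  assert (HR : forall e z, R e (nat_of_str z) = 0 -> exists p x,
     z = p ++ x /\ U p = Some (str_of_nat (length x)) /\ pfst (psnd e) = nat_of_str x).
  { intros e z. unfold R.
    destruct (Nat.eqb_spec (pfst e * 2 ^ slen (pfst (psnd e)) + pfst (psnd e)) (nat_of_str z))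
      as [H1|]; [|easy].
    destruct (Nat.eqb_spec (E (psnd (psnd e)) (pfst e)) (S (slen (pfst (psnd e))))) as [H2|];
      [|easy].
    intros _. exists (str_of_nat (pfst e)), (str_of_nat (pfst (psnd e))).
    assert (Hl : length (str_of_nat (pfst (psnd e))) = slen (pfst (psnd e)))
      by (now rewrite <- slen_nat_of_str, nat_of_str_of_nat).
    repeat split.
    - apply nat_of_str_inj. now rewrite nat_of_str_app, Hl, !nat_of_str_of_nat.
    - rewrite Hl. now apply E_output in H2.
    - now rewrite nat_of_str_of_nat. }
  destruct (search_machine R (fun e => pfst (psnd e))) as (T & HT & HTs).
  - unfold R. tc_machine.
  - tc_machine.
  - intros e e' z H H'. rewrite <- (nat_of_str_of_nat z) in H, H'.
    apply HR in H as (p & x & Hz & Hp & ->), H' as (p' & x' & Hz' & Hp' & ->).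
    rewrite Hz in Hz'.
    assert (p = p') as <- by (eapply domain_comparable; eauto using prefix_comparable).
    apply app_inv_head in Hz'. now subst.
  - destruct (K_le_machine U HU T) as [c Hc].
    + split; [easy|]. intros y y' Hy Hy' [r Hr].
      destruct (T y) as [w|] eqn:Ey; [|easy]. destruct (T y') as [w'|] eqn:Ey'; [|easy].
      apply HTs in Ey as (e & He & _), Ey' as (e' & He' & _).
      apply HR in He as (p & x & -> & Hp & _), He' as (p' & x' & -> & Hp' & _).
      rewrite <- app_assoc in Hr.
      assert (p = p') as <- by (eapply domain_comparable; eauto using prefix_comparable).
      apply app_inv_head in Hr. subst x'. rewrite Hp in Hp'. injection Hp' as Hl.
      apply (f_equal nat_of_str) in Hl. rewrite !nat_of_str_of_nat, length_app in Hl.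
      destruct r; [now rewrite app_nil_r|simpl in Hl; lia].
    + exists c. intros x. destruct (K_program U HU (str_of_nat (length x))) as (p & Hp & <-).
      rewrite (Nat.add_comm (length x)), <- length_app. apply Hc. apply HTs.
      pose proof Hp as Hs. apply HEU in Hs as [s Hs]. rewrite nat_of_str_of_nat in Hs.
      exists (npair (nat_of_str p) (npair (nat_of_str x) s)). unfold R.
      rewrite !psnd_pair, !pfst_pair, slen_nat_of_str, Hs, nat_of_str_app, !Nat.eqb_refl. easy.
Qed.

Lemma kraft_domain (l : list nat) s :
  NoDup l -> (forall p, In p l -> E s p <> 0) ->
  (rsum (fun p => (/ 2) ^ slen p) l <= 1)%R.
Proof.
  intros Hn Hl. apply Rle_trans with (rsum weight (map str_of_nat l)).
  - rewrite rsum_map. apply rsum_le. intros p _. unfold weight.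
    rewrite <- slen_nat_of_str, nat_of_str_of_nat. lra.
  - apply kraft.
    + apply Injective_map_NoDup; [|easy]. intros a b H.
      now rewrite <- (nat_of_str_of_nat a), H, nat_of_str_of_nat.
    + assert (Hd : forall y, In y (map str_of_nat l) -> U y <> None).
      { intros y Hy. apply in_map_iff in Hy as (p & <- & Hp). apply Hl in Hp.
        destruct (E s p) as [|x] eqn:Ep; [easy|]. apply E_output in Ep. congruence. }
      intros y y' Hy Hy'. apply (domain_prefix_free U HU); auto.
Qed.

(** * The coding theorem for output lengths *)

Lemma bsum_ext f g m : (forall p, f p = g p) -> bsum f m = bsum g m.
Proof. intros H. induction m; simpl; congruence. Qed.

Definition outputs_length (t n p : nat) : bool :=
  match E t p with 0 => false | S y => slen y =? n end.

(** A lower approximation to the probability that [U], fed with random bits, outputs a string of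
    length n. *)
Definition mass (t n : nat) : R :=
  rsum (fun p => (/ 2) ^ slen p)%R (filter (outputs_length t n) (seq 0 t)).

(** Only programs p < t count, so [slen p <= t] and no exponent is truncated. This natural number
    stands in for the real [mass] in computable tests. *)
Definition scaled_mass (t n : nat) : nat :=
  bsum (fun p => if outputs_length t n p then 2 ^ (t - slen p) else 0) t.

Lemma scaled_mass_spec t n : INR (scaled_mass t n) = (mass t n * 2 ^ t)%R.
Proof.
  unfold scaled_mass, mass. rewrite rsum_filter.
  assert (H : forall m, m <= t -> INR (bsum (fun p => if outputs_length t n p then
    2 ^ (t - slen p) else 0) m) =
    (rsum (fun p => if outputs_length t n p then (/ 2) ^ slen p else 0) (seq 0 m) * 2 ^ t)%R).
  { induction m as [|m IH]; intros Hm; [simpl; lra|].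
    rewrite seq_S, rsum_app. cbn [bsum]. rewrite plus_INR, IH by lia. simpl.
    destruct (outputs_length t n m); [|simpl; lra]. rewrite INR_pow2.
    replace (2 ^ (t - slen m))%R with ((/ 2) ^ slen m * 2 ^ t)%R; [lra|].
    replace t with (slen m + (t - slen m)) at 1 by (pose proof (slen_le m); lia).
    rewrite pow_add, <- Rmult_assoc, pow_half_inv. lra. }
  now apply H.
Qed.

Lemma tc_scaled_mass : total_computable 2 (fun v => scaled_mass (nth 0 v 0) (nth 1 v 0)).
Proof.
  unfold scaled_mass.
  eapply tc_ext; [apply (tc_bsum 2 (fun w => match E (nth 1 w 0) (nth 0 w 0) with 0 => 0
     | S _ => if slen (pred (E (nth 1 w 0) (nth 0 w 0))) =? nth 2 w 0 then
        2 ^ (nth 1 w 0 - slen (nth 0 w 0)) else 0 end) (fun v => nth 0 v 0)); tc_machine|].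
  intros v _. cbn [nth]. unfold outputs_length.
  apply bsum_ext. intros p. now destruct (E (nth 0 v 0) p).
Qed.

Lemma outputs_length_mono t t' n p : t <= t' ->
  outputs_length t n p = true -> outputs_length t' n p = true.
Proof.
  intros Ht. unfold outputs_length. destruct (E t p) as [|y] eqn:H; [easy|].
  now rewrite (Emono _ _ _ _ Ht H).
Qed.

Lemma mass_mono t t' n : t <= t' -> (mass t n <= mass t' n)%R.
Proof.
  intros Ht. apply rsum_incl.
  - intros. apply Rlt_le, pow_half_pos.
  - apply NoDup_filter, seq_NoDup.
  - intros p. rewrite !filter_In, !in_seq. intros [Hp Ho].
    split; [lia|]. now apply outputs_length_mono with t.
Qed.

Lemma mass_le_1 t n : (mass t n <= 1)%R.
Proof.
  apply kraft_domain with t; [apply NoDup_filter, seq_NoDup|].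
  intros p Hp. apply filter_In in Hp as [_ Hp]. unfold outputs_length in Hp. now destruct (E t p).
Qed.

(** After swapping the sums, each halted program counts for at most one n, and Kraft's inequality
    applies. *)
Lemma rsum_mass_le_1 t N : (rsum (mass t) (seq 0 N) <= 1)%R.
Proof.
  unfold mass. erewrite rsum_ext; [|intros; apply rsum_filter]. rewrite rsum_swap.
  apply Rle_trans with (rsum (fun p => if negb (E t p =? 0) then (/ 2) ^ slen p else
    0)%R (seq 0 t)).
  - apply rsum_le. intros p _. unfold outputs_length. destruct (E t p) as [|y]; simpl.
    + rewrite rsum_const. lra.
    + rewrite <- (rsum_filter (fun _ => ((/ 2) ^ slen p)%R) (fun n => slen y =? n)).
      apply Rle_trans with (rsum (fun _ => (/ 2) ^ slen p)%R [slen y]); [|simpl; lra].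
      apply rsum_incl.
      * intros _. apply Rlt_le, pow_half_pos.
      * apply NoDup_filter, seq_NoDup.
      * intros n Hn. apply filter_In in Hn as [_ Hn]. apply Nat.eqb_eq in Hn. now left.
  - rewrite <- rsum_filter. apply kraft_domain with t; [apply NoDup_filter, seq_NoDup|].
    intros p Hp. apply filter_In in Hp as [_ Hp]. now destruct (E t p).
Qed.

(** If k is the least index with [h k], the terms from k on sum to at most 2 (1/2)^k, which is at
    most [mu]. This is the origin of the factor 2 in the thresholds. *)
Lemma geometric_below (mu : R) (h : nat -> bool) N :
  (0 <= mu)%R -> (forall k, h k = true <-> 2 * (/ 2) ^ k <= mu)%R ->
  (rsum (fun k => if h k then (/ 2) ^ k else 0) (seq 0 N) <= mu)%R.
Proof.
  intros Hmu Hh.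
  (* Either nothing has been added so far, or there is room left for all terms from N on. *)
  assert (H : (rsum (fun k => if h k then (/ 2) ^ k else 0) (seq 0 N) <= 0 \/
    rsum (fun k => if h k then (/ 2) ^ k else 0) (seq 0 N) <= mu - 2 * (/ 2) ^ N)%R).
  { induction N as [|N IH]; [simpl; lra|].
    rewrite seq_S, rsum_app. simpl. pose proof (pow_half_pos N). specialize (Hh N).
    destruct (h N).
    - assert (2 * (/ 2) ^ N <= mu)%R by now apply Hh. right. destruct IH; lra.
    - assert (mu < 2 * (/ 2) ^ N)%R by (apply Rnot_le_lt; intros F; now apply Hh in F).
      left. destruct IH; lra. }
  pose proof (pow_half_pos N). lra.
Qed.

(* The coding theorem for the output lengths of [U]. *)
Lemma K_le_mass : exists c, forall t n k,
  (2 * (/ 2) ^ k <= mass t n)%R -> K (str_of_nat n) <= k + c.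
Proof.
  set (hit := fun t n k => 2 ^ S t <=? scaled_mass t n * 2 ^ k).
  assert (Hhit : forall t n k, hit t n k = true <-> (2 * (/ 2) ^ k <= mass t n)%R).
  { intros t n k. unfold hit. rewrite Nat.leb_le.
    pose proof (pow_lt 2 t ltac:(lra)). pose proof (pow_lt 2 k ltac:(lra)) as Hk.
    pose proof (pow_half_inv k) as Hi.
    assert (Hr : (INR (2 ^ S t) <= INR (scaled_mass t n * 2 ^ k) <-> 2 * (/ 2) ^ k <= mass t n)%R).
    { rewrite mult_INR, scaled_mass_spec, !INR_pow2. simpl.
      replace (2 * 2 ^ t)%R with (2 * (/ 2) ^ k * (2 ^ t * 2 ^ k))%R
        by (transitivity (2 * 2 ^ t * ((/ 2) ^ k * 2 ^ k))%R; [lra|rewrite Hi; lra]).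
      rewrite (Rmult_assoc (mass t n)). split; intros Hle.
      - apply Rmult_le_reg_r in Hle; [easy|]. now apply Rmult_lt_0_compat.
      - apply Rmult_le_compat_r; [|easy]. apply Rlt_le. now apply Rmult_lt_0_compat. }
    rewrite <- Hr. split; [apply le_INR|apply INR_le]. }
  assert (Hmono : forall t t' n k, t <= t' -> hit t n k = true -> hit t' n k = true).
  { intros t t' n k Ht. rewrite !Hhit. pose proof (mass_mono t t' n Ht). lra. }
  (* Here e codes n, k and t. Not every number is a code and decoding is not injective, so the first
     test keeps canonical codes only. The threshold is met at stage t + 1 but not at t; nothing is
     lost, since the mass at stage 0 is zero. *)
  set (req := fun e =>
    if npair (pfst e) (npair (pfst (psnd e)) (psnd (psnd e))) =? e then
    if hit (S (psnd (psnd e))) (pfst e) (pfst (psnd e)) then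
    if hit (psnd (psnd e)) (pfst e) (pfst (psnd e)) then 1 else 0 else 1 else 1).
  assert (Hreq : forall e, req e = 0 <->
     e = npair (pfst e) (npair (pfst (psnd e)) (psnd (psnd e))) /\
     hit (S (psnd (psnd e))) (pfst e) (pfst (psnd e)) = true /\
     hit (psnd (psnd e)) (pfst e) (pfst (psnd e)) = false).
  { intros e. unfold req.
    destruct (Nat.eqb_spec (npair (pfst e) (npair (pfst (psnd e)) (psnd (psnd e)))) e) as [H|H].
    - destruct (hit (S _) _ _), (hit (psnd _) _ _); intuition congruence.
    - split; [easy|]. intros [H' _]. congruence. }
  destruct (kraft_chaitin U HU req (fun e => pfst (psnd e)) pfst) as [c Hc].
  - pose proof tc_scaled_mass as HS. unfold req, hit. tc_machine.
  - tc_machine.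
  - tc_machine.
  - intros e. pose proof (pfst_le (psnd e)). pose proof (psnd_le e). lia.
  - intros N.
    set (L := filter (fun e => req e =? 0) (seq 0 N)).
    assert (HL : forall e, In e L -> e < N /\ req e = 0).
    { intros e He. apply filter_In in He as [He1 He2]. apply in_seq in He1.
      apply Nat.eqb_eq in He2. lia. }
    set (f := fun e => (pfst e, pfst (psnd e))).
    apply Rle_trans with (rsum (fun nk : nat * nat => (/ 2) ^ snd nk)%R (map f L));
      [rewrite rsum_map; apply Rle_refl|].
    apply Rle_trans with (rsum (fun nk : nat * nat => (/ 2) ^ snd nk)%R
      (filter (fun nk => hit N (fst nk) (snd nk)) (list_prod (seq 0 N) (seq 0 N)))).
    + apply rsum_incl.
      * intros. apply Rlt_le, pow_half_pos.
      * apply Injective_map_NoDup_in; [|apply NoDup_filter, seq_NoDup].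
        (* a request is made only at the first stage that justifies it *)
        intros e e' He He' Hf. apply HL in He as [_ He], He' as [_ He'].
        apply Hreq in He as (Ee & H1 & H2), He' as (Ee' & H1' & H2').
        unfold f in Hf. injection Hf as Hf1 Hf2. rewrite <- Hf1, <- Hf2 in *.
        rewrite Ee, Ee'. do 2 f_equal.
        destruct (Nat.lt_trichotomy (psnd (psnd e)) (psnd (psnd e'))) as [Hlt|[Heq|Hlt]]; [|easy|].
        -- rewrite (Hmono _ _ _ _ Hlt H1) in H2'. easy.
        -- rewrite (Hmono _ _ _ _ Hlt H1') in H2. easy.
      * intros nk Hnk. apply in_map_iff in Hnk as (e & <- & He). apply HL in He as [HeN He].
        apply Hreq in He as (_ & H1 & _). unfold f.
        pose proof (pfst_le e). pose proof (pfst_le (psnd e)). pose proof (psnd_le e).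
        pose proof (psnd_le (psnd e)).
        apply filter_In. split.
        -- apply in_prod; apply in_seq; lia.
        -- apply Hmono with (S (psnd (psnd e))); [lia|easy].
    + rewrite rsum_filter, rsum_list_prod. simpl.
      apply Rle_trans with (rsum (mass N) (seq 0 N)); [|apply rsum_mass_le_1].
      apply rsum_le. intros n _. apply geometric_below.
      * apply rsum_nonneg. intros. apply Rlt_le, pow_half_pos.
      * intros k. apply Hhit.
  - exists c. intros t n k H. apply Hhit in H.
    assert (exists t, hit (S t) n k = true /\ hit t n k = false) as (t' & H1 & H2).
    { induction t as [|t IH].
      - exfalso. apply Hhit in H. unfold mass in H. simpl in H. pose proof (pow_half_pos k). lra.
      - destruct (hit t n k) eqn:Ht; [auto|eauto]. }
    specialize (Hc (npair n (npair k t'))). rewrite !psnd_pair, !pfst_pair in Hc. apply Hc.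
    apply Hreq. now rewrite !psnd_pair, !pfst_pair.
Qed.

(** * Counting strings of low complexity *)

Definition shortest (x : str) : str :=
  proj1_sig (constructive_indefinite_description _ (K_program U HU x)).

Lemma shortest_spec x : U (shortest x) = Some x /\ length (shortest x) = K x.
Proof. unfold shortest. now destruct (constructive_indefinite_description _ _). Qed.

Lemma shortest_inj x y : shortest x = shortest y -> x = y.
Proof.
  intros H. destruct (shortest_spec x) as [Hx _], (shortest_spec y) as [Hy _]. congruence.
Qed.

Lemma kraft_K l : NoDup l -> (rsum (fun x => (/ 2) ^ K x) l <= 1)%R.
Proof.
  intros Hl. apply Rle_trans with (rsum weight (map shortest l)).
  - rewrite rsum_map. apply rsum_le. intros x _. unfold weight.
    rewrite (proj2 (shortest_spec x)). lra.
  - apply kraft.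
    + apply Injective_map_NoDup; [|easy]. intros x y. apply shortest_inj.
    + intros y y' Hy Hy'. apply in_map_iff in Hy as (x & <- & _), Hy' as (x' & <- & _).
      apply (domain_prefix_free U HU).
      * now rewrite (proj1 (shortest_spec x)).
      * now rewrite (proj1 (shortest_spec x')).
Qed.

(** The shortest programs of the strings in [L] are distinct, so at a late stage the mass of n is at
    least |L| (1/2)^j; the coding theorem then bounds K n. *)
Lemma count_low_complexity : exists c, forall n j (L : list str),
  NoDup L -> (forall x, In x L -> length x = n /\ K x <= j) ->
  length L * 2 ^ K (str_of_nat n) <= 2 ^ (j + c).
Proof.
  (* One successor pays for the factor 2 in [K_le_mass], the other for rounding the length of [L] to
     a power of two. *)
  destruct K_le_mass as [c Hc]. exists (S (S c)). intros n j L Hn HL.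
  assert (exists t, forall x, In x L ->
     nat_of_str (shortest x) < t /\ E t (nat_of_str (shortest x)) = S (nat_of_str x)) as [t Ht].
  { clear Hn HL. induction L as [|x L [t IH]]; [exists 0; easy|].
    destruct (proj1 (HEU _ _) (proj1 (shortest_spec x))) as [s Hs].
    exists (t + s + S (nat_of_str (shortest x))). intros y [<-|Hy].
    - split; [lia|]. apply Emono with s; [lia|easy].
    - destruct (IH y Hy) as [H1 H2]. split; [lia|]. apply Emono with t; [lia|easy]. }
  assert (Hmass : (INR (length L) * (/ 2) ^ j <= mass t n)%R).
  { rewrite <- rsum_const.
    apply Rle_trans with (rsum (fun p => (/ 2)
      ^ slen p)%R (map (fun x => nat_of_str (shortest x)) L)).
    - rewrite rsum_map. apply rsum_le. intros x Hx. rewrite slen_nat_of_str.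
      rewrite (proj2 (shortest_spec x)). apply pow_half_le. now apply HL.
    - apply rsum_incl.
      + intros. apply Rlt_le, pow_half_pos.
      + apply Injective_map_NoDup; [|easy]. intros x y H. now apply shortest_inj, nat_of_str_inj.
      + intros p Hp. apply in_map_iff in Hp as (x & <- & Hx). destruct (Ht x Hx) as [H1 H2].
        apply filter_In. split; [apply in_seq; lia|]. unfold outputs_length.
        rewrite H2, slen_nat_of_str. apply Nat.eqb_eq. now apply HL. }
  destruct L as [|x0 L0]; [simpl; lia|]. set (L := x0 :: L0) in *.
  set (i := Nat.log2 (length L)).
  assert (Hi : 2 ^ i <= length L < 2 ^ S i) by (apply Nat.log2_spec; simpl; lia).
  assert (Hr : (INR (length L) * (/ 2) ^ j * 2 ^ j = INR (length L))%R)
    by (rewrite Rmult_assoc, pow_half_inv; lra).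
  assert (Hij : i <= j).
  { apply (Nat.pow_le_mono_r_iff 2); [lia|]. apply Nat.le_trans with (length L); [easy|].
    apply INR_le. rewrite INR_pow2, <- Hr. pose proof (mass_le_1 t n).
    rewrite <- (Rmult_1_l (2 ^ j)) at 2. apply Rmult_le_compat_r; [apply pow_le; lra|lra]. }
  assert (HK : K (str_of_nat n) <= S (j - i) + c).
  { apply (Hc t). simpl. apply Rle_trans with (INR (length L) * (/ 2) ^ j)%R; [|easy].
    apply Rle_trans with (INR (2 ^ i) * (/ 2) ^ j)%R.
    - rewrite INR_pow2. replace j with (i + (j - i)) at 2 by lia. rewrite pow_add.
      pose proof (pow_half_inv i) as H. rewrite <- (Rmult_assoc (2 ^ i)), (Rmult_comm (2 ^ i)),
        H. lra.
    - apply Rmult_le_compat_r; [apply Rlt_le, pow_half_pos|]. now apply le_INR. }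
  apply Nat.le_trans with (2 ^ S i * 2 ^ (S (j - i) + c)).
  - apply Nat.mul_le_mono; [lia|]. apply Nat.pow_le_mono_r; lia.
  - rewrite <- Nat.pow_add_r. apply Nat.pow_le_mono_r; lia.
Qed.

(** * The iterated busy beaver *)

(* A busy-beaver-like function approximated from below; the sum stands in for
   a maximum over the outputs of programs of length at most [k]. *)
Definition beaver (s k : nat) : nat :=
  S (k + bsum (fun p => match E s p with 0 => 0 | S n => if slen p <=? k then n else 0 end) s).

Definition tower (s i : nat) : nat := prim_rec 0 (fun _ b => beaver s b) i.

(** Says that the i-th iterate of the limit of [beaver] is at least j, without constructing that
    limit. In this form it is c.e. *)
Definition reach (i j : nat) : Prop := exists s, j <= tower s i.

Lemma tc_tower : total_computable 2 (fun v => tower (nth 0 v 0) (nth 1 v 0)).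
Proof.
  assert (total_computable 2 (fun v => beaver (nth 0 v 0) (nth 1 v 0))).
  { unfold beaver. tc_machine.
    eapply tc_ext; [apply (tc_bsum 2 (fun w => match E (nth 1 w 0) (nth 0 w 0) with 0 => 0
       | S _ => if slen (nth 0 w 0) <=? nth 2 w 0 then pred (E (nth 1 w 0) (nth 0 w 0)) else 0 end)
       (fun v => nth 0 v 0)); tc_machine|].
    intros v _. cbn [nth]. apply bsum_ext. intros p. now destruct (E (nth 0 v 0) p). }
  apply (tc_rec 2 (fun _ => 0) (fun w => beaver (nth 2 w 0) (nth 1 w 0)) (fun v => nth 1 v 0));
    tc_machine.
Qed.

Lemma bsum_le f g m : (forall p, p < m -> f p <= g p) -> bsum f m <= bsum g m.
Proof.
  induction m as [|m IH]; simpl; intros H; [lia|].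
  specialize (IH ltac:(auto)). specialize (H m ltac:(lia)). lia.
Qed.

Lemma bsum_le_size f m m' : m <= m' -> bsum f m <= bsum f m'.
Proof. induction 1; simpl; lia. Qed.

Lemma bsum_term f m p : p < m -> f p <= bsum f m.
Proof.
  intros H. apply Nat.le_trans with (bsum f (S p)); [simpl; lia|]. now apply bsum_le_size.
Qed.

Lemma beaver_mono s s' k k' : s <= s' -> k <= k' -> beaver s k <= beaver s' k'.
Proof.
  intros Hs Hk. unfold beaver. apply le_n_S, Nat.add_le_mono; [easy|].
  eapply Nat.le_trans; [|apply bsum_le_size, Hs]. apply bsum_le. intros p _.
  destruct (E s p) as [|n] eqn:H; [lia|]. rewrite (Emono _ _ _ _ Hs H).
  destruct (Nat.leb_spec (slen p) k), (Nat.leb_spec (slen p) k'); lia.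
Qed.

Lemma tower_mono s s' i : s <= s' -> tower s i <= tower s' i.
Proof. intros Hs. induction i; [easy|]. now apply beaver_mono. Qed.

Lemma tower_S s i : S (tower s i) <= tower s (S i).
Proof.
  change (S (tower s i) <= beaver s (tower s i)). generalize (tower s i).
  intros k. unfold beaver. lia.
Qed.

Lemma reach_S i j : reach i j -> reach (S i) (S j).
Proof. intros [s H]. exists s. pose proof (tower_S s i). lia. Qed.

Lemma reach_le i i' j j' : i <= i' -> j' <= j -> reach i j -> reach i' j'.
Proof.
  intros Hi Hj [s H]. exists s. apply Nat.le_trans with (tower s i); [lia|]. clear - Hi.
  induction Hi as [|i' _ IH]; [lia|]. pose proof (tower_S s i'). lia.
Qed.

(** At a late stage the tower value k is at least |p|, so the next application of [beaver] counts
    the output of p and adds k on top. *)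
Lemma reach_output i p x : U p = Some x -> reach i (length p) ->
  reach (S i) (nat_of_str x + length p).
Proof.
  intros Hp [s Hs]. apply HEU in Hp as [s' Hp].
  set (t := s + s' + S (nat_of_str p)).
  exists t. change (nat_of_str x + length p <= beaver t (tower t i)).
  assert (Ht : length p <= tower t i).
  { pose proof (tower_mono s t i ltac:(lia)). lia. }
  generalize dependent (tower t i). intros k Ht. unfold beaver.
  pose proof (bsum_term (fun p => match E t p with 0 => 0 | S n => if slen p <=? k then n else
    0 end)
    t (nat_of_str p) ltac:(lia)) as H. cbv beta in H.
  rewrite (Emono s' t _ _ ltac:(lia) Hp), slen_nat_of_str in H.
  destruct (Nat.leb_spec (length p) k); lia.
Qed.

(** Only programs of length at most k contribute; their codes lie below 2 ^ (k + 1), and each has at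
    most one output over all stages. *)
Lemma beaver_bounded k : exists b, forall s, beaver s k <= b.
Proof.
  set (term := fun s p => match E s p with 0 => 0 | S n => if slen p <=? k then n else 0 end).
  assert (H : forall M, exists b, forall s, bsum (term s) M <= b).
  { induction M as [|M [b IH]]; [exists 0; simpl; lia|].
    destruct (classic (exists s n, E s M = S n)) as [(s0 & n & H)|H].
    - exists (b + n). intros s. simpl. specialize (IH s).
      assert (term s M <= n); [|lia]. unfold term.
      destruct (E s M) as [|n'] eqn:H'; [lia|].
      pose proof (Emono s0 (s0 + s) _ _ ltac:(lia) H). pose proof (Emono s (s0 + s)
        _ _ ltac:(lia) H').
      destruct (slen M <=? k); lia || congruence.
    - exists b. intros s. simpl. specialize (IH s). unfold term at 2.
      destruct (E s M) as [|n'] eqn:H'; [lia|]. elim H. eauto. }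
  destruct (H (2 ^ S k)) as [b Hb]. exists (S (k + b)). intros s. unfold beaver. fold (term s).
  apply le_n_S, Nat.add_le_mono_l. apply Nat.le_trans with (bsum (term s) (2 ^ S k)); [|easy].
  clear H Hb. induction s as [|s' IH] at 2; simpl (bsum _ 0); [lia|].
  cbn [bsum]. destruct (le_lt_dec (2 ^ S k) s') as [Hs|Hs].
  - assert (Hz : term s s' = 0); [|lia]. unfold term. destruct (E s s'); [easy|].
    destruct (Nat.leb_spec (slen s') k) as [Hk|]; [|easy].
    pose proof (nat_of_str_bounds (str_of_nat s')) as Hb. rewrite <- slen_nat_of_str,
      nat_of_str_of_nat in Hb.
    pose proof (Nat.pow_le_mono_r 2 (S (slen s')) (S k) ltac:(lia) ltac:(lia)). lia.
  - change (bsum (term s) (S s') <= bsum (term s) (2 ^ S k)). now apply bsum_le_size.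
Qed.

Lemma tower_bounded i : exists b, forall s, tower s i <= b.
Proof.
  induction i as [|i [b IH]]; [exists 0; intros; apply le_n|].
  destruct (beaver_bounded b) as [b' Hb']. exists b'. intros s.
  apply Nat.le_trans with (beaver s b); [|easy]. apply beaver_mono; [easy|apply IH].
Qed.

(** * The slow function [g] of the overview, here [rank] *)

Definition is_rank (j i : nat) : Prop := reach i j /\ forall i', reach i' j -> i <= i'.
Definition rank (j : nat) : nat := epsilon (inhabits 0) (is_rank j).

Lemma rank_spec j : is_rank j (rank j).
Proof.
  apply (epsilon_spec (inhabits 0) (is_rank j)).
  destruct (dec_inh_nat_subset_has_unique_least_element (fun i => reach i j)) as (i & Hi & _).
  - intros. apply classic.
  - exists j. induction j as [|j IH]; [exists 0; apply le_n|]. now apply reach_S.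
  - exists i. easy.
Qed.

Lemma rank_le i j : reach i j -> rank j <= i.
Proof. apply rank_spec. Qed.

Lemma rank_mono j j' : j <= j' -> rank j <= rank j'.
Proof. intros H. apply rank_le. eapply reach_le, rank_spec; easy. Qed.

Lemma rank_add j c : rank (j + c) <= rank j + c.
Proof.
  apply rank_le. rewrite (Nat.add_comm j), (Nat.add_comm _ c).
  induction c as [|c IH]; [apply rank_spec|]. now apply reach_S.
Qed.

Lemma rank_output n : rank (n + K (str_of_nat n)) <= S (rank (K (str_of_nat n))).
Proof.
  destruct (K_program U HU (str_of_nat n)) as (p & Hp & <-). apply rank_le.
  rewrite <- (nat_of_str_of_nat n) at 1. apply reach_output; [easy|]. apply rank_spec.
Qed.

Lemma rank_unbounded m : exists j, m < rank j.
Proof.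
  destruct (tower_bounded m) as [b Hb]. exists (S b). apply Nat.nle_gt. intros H.
  destruct (reach_le _ m _ (S b) H (Nat.le_refl _) (proj1 (rank_spec (S b)))) as [s Hs].
  specialize (Hb s). lia.
Qed.

Lemma str_of_nat_inj a b : str_of_nat a = str_of_nat b -> a = b.
Proof. intros H. now rewrite <- (nat_of_str_of_nat a), H, nat_of_str_of_nat. Qed.

(** Otherwise 2 ^ j + 1 strings of complexity at most j would violate Kraft's inequality. *)
Lemma K_unbounded j : exists x, j <= K x.
Proof.
  apply NNPP. intros H.
  assert (Hlt : forall x, K x <= j).
  { intros x. destruct (le_lt_dec j (K x)); [elim H; eauto|lia]. }
  pose proof (kraft_K (map str_of_nat (seq 0 (S (2 ^ j))))
    (Injective_map_NoDup str_of_nat_inj (seq_NoDup _ _))) as Hk.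
  assert (Hge : (INR (S (2 ^ j)) * (/ 2) ^ j <= 1)%R).
  { eapply Rle_trans; [|exact Hk]. rewrite rsum_map.
    rewrite <- (length_seq (S (2 ^ j)) 0) at 1. rewrite <- rsum_const.
    apply rsum_le. intros n _. now apply pow_half_le. }
  rewrite S_INR, INR_pow2, Rmult_plus_distr_r, Rmult_comm, pow_half_inv in Hge.
  pose proof (pow_half_pos j). lra.
Qed.

(** * The function A and its properties *)

Definition slow_complexity (x : str) : nat := K x + rank (K x).

(** The search looks for any program q of x and any i with [reach i] at |q| and |q| + i <= k;
    neither minimum is computed. It is sound because [rank] is monotone: rank (K x) <= rank |q| <=
    i. *)
Lemma slow_complexity_upper : upper_semicomputable slow_complexity.
Proof.
  pose proof tc_tower as Ht.
  destruct (search_computable 2 (fun v =>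
     if E (pfst (nth 0 v 0)) (pfst (psnd (nth 0 v 0))) =? S (nth 1 v 0) then
     if slen (pfst (psnd (nth 0 v 0))) + psnd (psnd (nth 0 v 0)) <=? nth 2 v 0 then
     if slen (pfst (psnd (nth 0 v 0))) <=? tower (pfst (nth 0 v 0)) (psnd (psnd (nth 0 v 0)))
     then 0 else 1 else 1 else 1) (fun _ => 0)) as [p Hp]; [tc_machine|tc_machine|].
  exists p. intros x k. destruct (Hp [nat_of_str x; k] eq_refl) as [H1 H2].
  cbn [nth] in H1, H2. split.
  - intros HA. apply H2. clear H1 H2.
    destruct (K_program U HU x) as (q & Hq & Hl). destruct (rank_spec (K x)) as [[s Hs] _].
    pose proof Hq as Hr. apply HEU in Hr as [s' Hr].
    exists (npair (s + s') (npair (nat_of_str q) (rank (K x)))).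
    rewrite !psnd_pair, !pfst_pair, (Emono s' (s + s') _ _ ltac:(lia) Hr), slen_nat_of_str,
      Nat.eqb_refl, Hl.
    unfold slow_complexity in HA. pose proof (tower_mono s (s + s') (rank (K x)) ltac:(lia)).
    destruct (Nat.leb_spec (K x + rank (K x)) k); [|lia].
    destruct (Nat.leb_spec (K x) (tower (s + s') (rank (K x)))); lia.
  - intros [y Hy]. destruct (H1 y Hy) as (e & He & _). clear H1 H2 Hy. revert He.
    destruct (Nat.eqb_spec (E (pfst e) (pfst (psnd e))) (S (nat_of_str x))) as [He|]; [|easy].
    destruct (Nat.leb_spec (slen (pfst (psnd e)) + psnd (psnd e)) k) as [Hk|]; [|easy].
    destruct (Nat.leb_spec (slen (pfst (psnd e))) (tower (pfst e) (psnd (psnd e)))) as [Ht'|];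
      [|easy].
    intros _. apply E_output in He. rewrite str_of_nat_of_str in He.
    apply (K_le_length U HU) in He. rewrite <- slen_nat_of_str, nat_of_str_of_nat in He.
    pose proof (rank_mono _ _ He).
    pose proof (rank_le (psnd (psnd e)) (slen (pfst (psnd e))) (ex_intro _ _ Ht')).
    unfold slow_complexity. lia.
Qed.

Lemma slow_complexity_le x y c : K y <= K x + c ->
  slow_complexity y <= slow_complexity x + 2 * c.
Proof.
  intros H. unfold slow_complexity. apply rank_mono in H as Hr.
  pose proof (rank_add (K x) c). lia.
Qed.

Lemma slow_complexity_summable :
  exists l, infinite_sum (fun n => (/ 2) ^ slow_complexity (str_of_nat n))%R l.
Proof.
  set (f := fun n => ((/ 2) ^ slow_complexity (str_of_nat n))%R).
  destruct (growing_cv (sum_f_R0 f)) as [l Hl].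
  - intros n. simpl. pose proof (pow_half_pos (slow_complexity (str_of_nat (S n)))).
    unfold f at 3. lra.
  - exists 1%R. intros r [n ->].
    assert (Es : sum_f_R0 f n = rsum f (seq 0 (S n))).
    { induction n as [|n IH]; [simpl; lra|]. cbn [sum_f_R0]. rewrite IH, (seq_S (S n)), rsum_app.
      simpl. lra. }
    rewrite Es. apply Rle_trans with (rsum (fun x => (/ 2) ^ K x)%R (map str_of_nat (seq 0 (S n)))).
    + rewrite rsum_map. apply rsum_le. intros m _. apply pow_half_le. unfold slow_complexity. lia.
    + apply kraft_K. apply (Injective_map_NoDup str_of_nat_inj), seq_NoDup.
  - exists l. exact Hl.
Qed.

Lemma slow_complexity_le_length : exists c, forall x,
  slow_complexity x <= length x + slow_complexity (str_of_nat (length x)) + c.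
Proof.
  (* The first [c] is the loss in K, the second its effect on [rank], and the successor comes from
     [rank_output]. *)
  destruct K_le_length_add as [c Hc]. exists (c + S c). intros x. specialize (Hc x).
  apply rank_mono in Hc as Hr. unfold slow_complexity.
  pose proof (rank_add (length x + K (str_of_nat (length x))) c).
  pose proof (rank_output (length x)). lia.
Qed.

Lemma in_all_strs n x : In x (all_strs n) -> length x = n.
Proof.
  revert x. induction n as [|n IH]; simpl; intros x H.
  - now destruct H as [<-|[]].
  - apply in_flat_map in H as (y & Hy & [<-|[<-|[]]]); simpl; now rewrite IH.
Qed.

Lemma NoDup_all_strs n : NoDup (all_strs n).
Proof.
  induction n as [|n IH]; simpl; [repeat constructor; easy|].
  induction IH as [|y l Hy _ IHl]; simpl; [constructor|].
  assert (H : forall b, ~ In (b :: y) (flat_map (fun s => [false :: s; true :: s]) l)).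
  { intros b H. apply in_flat_map in H as (z & Hz & Hb). apply Hy.
    destruct Hb as [E'|[E'|[]]]; injection E' as _ ->; easy. }
  constructor.
  - intros [H'|H']; [easy|]. now apply (H false).
  - constructor; [apply (H true)|easy].
Qed.

Lemma slow_complexity_count : exists c, forall n b,
  (INR (length (filter (fun x => Z.leb (Z.of_nat (slow_complexity x))
      (Z.of_nat n + Z.of_nat (slow_complexity (str_of_nat n)) - Z.of_nat b)) (all_strs n)))
   <= c * powerRZ 2 (Z.of_nat n - Z.of_nat b))%R.
Proof.
  destruct (K_length_le U HU) as [c1 H1]. destruct count_low_complexity as [c2 H2].
  exists (2 ^ (c1 + c2))%R. intros n b. set (L := filter _ _).
  assert (HL : forall x, In x L -> length x = n /\ K x + b <= n + K (str_of_nat n) + c1).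
  { intros x Hx. apply filter_In in Hx as [Hx HA]. apply in_all_strs in Hx. split; [easy|].
    specialize (H1 x). rewrite Hx in H1. apply rank_mono in H1 as Hr.
    pose proof (rank_add (K x) c1). apply Z.leb_le in HA. unfold slow_complexity in HA. lia. }
  assert (Hc : length L * 2 ^ K (str_of_nat n) * 2 ^ b <= 2 ^ (n + K (str_of_nat n) + c1 + c2)).
  { destruct (le_lt_dec b (n + K (str_of_nat n) + c1)) as [Hb|Hb].
    - apply Nat.le_trans with (2 ^ (n + K (str_of_nat n) + c1 - b + c2) * 2 ^ b).
      + apply Nat.mul_le_mono_r. apply H2; [apply NoDup_filter, NoDup_all_strs|].
        intros x Hx. destruct (HL x Hx). lia.
      + rewrite <- Nat.pow_add_r. apply Nat.pow_le_mono_r; lia.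
    - destruct L as [|x L']; [simpl; lia|]. destruct (HL x (or_introl eq_refl)). lia. }
  apply le_INR in Hc. rewrite !mult_INR, !INR_pow2 in Hc.
  unfold Z.sub. rewrite powerRZ_add by lra. rewrite powerRZ_neg', <- !pow_powerRZ.
  replace (n + K (str_of_nat n) + c1 + c2) with (K (str_of_nat n) + (c1 + c2 + n)) in Hc by lia.
  rewrite (pow_add 2 (K _)), (Rmult_comm (INR _)), Rmult_assoc in Hc.
  apply Rmult_le_reg_l in Hc; [|apply pow_lt; lra].
  pose proof (pow_lt 2 b ltac:(lra)) as Hb.
  apply (Rmult_le_reg_r (2 ^ b)); [easy|]. rewrite !Rmult_assoc, Rinv_l by lra.
  rewrite Rmult_1_r, <- pow_add. exact Hc.
Qed.

End SlowComplexity.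

(* U is the fixed optimal prefix-free machine; K = C_U, expressed by [C_is U]. *)
Theorem theorem3 (U : str -> option str) (HU : optimal_prefix_free U) :
  exists A : str -> nat,
    (* (1) *) upper_semicomputable A /\
    (* (2) *) (forall f : str -> option str, partial_computable f ->
                 exists cf : nat, forall x y, f x = Some y -> A y <= A x + cf) /\
    (* (3) *) (exists l : R,
                 infinite_sum (fun n => (/ 2) ^ (A (str_of_nat n)))%R l) /\
    (* (4) *) (exists c : nat, forall x : str,
                 A x <= length x + A (str_of_nat (length x)) + c) /\
    (* (5) *) (exists c' : R, forall n b : nat,
                 (INR (length (filter
                    (fun x => Z.leb (Z.of_nat (A x))
                       (Z.of_nat n + Z.of_nat (A (str_of_nat n)) - Z.of_nat b))
                    (all_strs n)))
                  <= c' * powerRZ 2 (Z.of_nat n - Z.of_nat b))%R) /\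
    (* (6) *) (forall m : nat, exists (x : str) (k : nat),
                 C_is U x k /\ (Z.of_nat m < Z.abs (Z.of_nat (A x) - Z.of_nat k))%Z).
Proof.
  destruct (machine_stages U (proj1 (proj1 HU))) as (E & HE & Emono & HEU).
  exists (slow_complexity U E). repeat apply conj.
  - now apply slow_complexity_upper.
  - intros f Hf. destruct (K_map_le U HU f Hf) as [c Hc]. exists (2 * c).
    intros x y Hxy. apply slow_complexity_le; eauto.
  - now apply slow_complexity_summable.
  - now apply slow_complexity_le_length.
  - now apply slow_complexity_count.
  (* The difference of A and K at x is exactly rank (K x), so any x with K x >= j serves. *)
  - intros m. destruct (rank_unbounded E Emono m) as [j Hj].
    destruct (K_unbounded U HU j) as [x Hx]. apply (rank_mono E) in Hx.
    exists x, (prefix_complexity U x). split; [now apply K_spec|].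
    unfold slow_complexity. lia.
Qed.
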